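(* Let $n\ge2$, $U\subseteq\mathbb{R}^n$ open, and $f,g\in C(U,\mathbb{R}^n)$ both injective. Let $W$ be a connected open subset of $\mathbb{R}^n$ with $\overline W$ a compact subset of $f(U)$. Choose $y\in W$ and $\delta,\eta>0$ with $y+Z_{\delta,\eta}(0)\subseteq W$ such that the closure of $W_{\delta,\eta}:=W+Z_{\delta,\eta}(0)$ is still a subset of $f(U)$. Put $A:=f^{-1}(\overline{W_{\delta,\eta}})$ and write $f=(\hat f,f^n)$, $g=(\hat g,g^n)$. If $$\|\hat g-\hat f\|_{\infty,A}<\delta\quad\text{and}\quad\|g^n-f^n\|_{\infty,A}<\eta,$$ then $\overline W\subseteq g(A)^\circ$ (the interior of $g(A)$).
   Context: For $x=(x^1,\dots,x^n)\in\mathbb{R}^n$ write $\hat x=(x^1,\dots,x^{n-1})$; for a map $f=(f^1,\dots,f^n)$ write $\hat f=(f^1,\dots,f^{n-1})$. The cylinder $Z_{\delta,\eta}(x):=B_\delta(\hat x)\times(x^n-\eta,x^n+\eta)$, where $B_\delta(\hat x)$ is the open Euclidean ball in $\mathbb{R}^{n-1}$. $W+Z$ denotes the Minkowski sum. *)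

(* Defs.v *)
From Stdlib Require Import Reals.
From mathcomp Require Import all_boot.
Set Implicit Arguments. Unset Strict Implicit.
Open Scope R_scope.

Definition vec (k : nat) := 'I_k -> R.
Definition vset (k : nat) := vec k -> Prop.

Definition vzero {k} : vec k := fun _ => 0.
Definition vadd {k} (x y : vec k) : vec k := fun i => x i + y i.

Definition vdist {k} (x y : vec k) : R :=
  sqrt (\big[Rplus/0]_(i < k) Rsqr (x i - y i)).

Definition is_open {k} (S : vset k) : Prop :=
  forall x, S x -> exists e, 0 < e /\ forall y, vdist y x < e -> S y.
Definition vclosure {k} (S : vset k) : vset k :=
  fun x => forall e, 0 < e -> exists y, S y /\ vdist y x < e.
Definition vinterior {k} (S : vset k) : vset k :=
  fun x => exists e, 0 < e /\ forall y, vdist y x < e -> S y.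
Definition vsubset {k} (S T : vset k) : Prop := forall x, S x -> T x.
Definition vcompact {k} (K : vset k) : Prop :=
  forall F : vset k -> Prop,
    (forall O, F O -> is_open O) ->
    (forall x, K x -> exists O, F O /\ O x) ->
    exists l : list (vset k),
      (forall O, List.In O l -> F O) /\
      (forall x, K x -> exists O, List.In O l /\ O x).
Definition vconnected {k} (S : vset k) : Prop :=
  forall O1 O2 : vset k, is_open O1 -> is_open O2 ->
    vsubset S (fun x => O1 x \/ O2 x) ->
    (forall x, S x -> O1 x -> O2 x -> False) ->
    (exists x, S x /\ O1 x) -> (exists x, S x /\ O2 x) -> False.

Definition continuous_on {k l} (f : vec k -> vec l) (U : vset k) : Prop :=
  forall x, U x -> forall e, 0 < e -> exists d, 0 < d /\
    forall y, U y -> vdist y x < d -> vdist (f y) (f x) < e.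
Definition injective_on {k l} (f : vec k -> vec l) (U : vset k) : Prop :=
  forall x y, U x -> U y -> f x = f y -> x = y.
Definition vimage {k l} (f : vec k -> vec l) (U : vset k) : vset l :=
  fun p => exists x, U x /\ f x = p.
Definition preimage_on {k l} (f : vec k -> vec l) (U : vset k) (S : vset l)
  : vset k := fun x => U x /\ S (f x).

Definition hatv {m} (x : vec m.+1) : vec m := fun i => x (widen_ord (leqnSn m) i).
Definition lastc {m} (x : vec m.+1) : R := x ord_max.

Definition cyl {m} (delta eta : R) (x : vec m.+1) : vset m.+1 :=
  fun z => vdist (hatv z) (hatv x) < delta /\ Rabs (lastc z - lastc x) < eta.

Definition msum {k} (S T : vset k) : vset k :=
  fun p => exists s t, S s /\ T t /\ p = vadd s t.
Definition translate {k} (y : vec k) (T : vset k) : vset k :=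
  fun p => exists t, T t /\ p = vadd y t.

(* Main.v *)
Require Import Defs.
From Stdlib Require Import Reals Lra Lia ClassicalEpsilon FunctionalExtensionality.
From HB Require Import structures.
From mathcomp Require Import all_boot fingroup perm.
Set Implicit Arguments. Unset Strict Implicit.
Open Scope R_scope.

(** For [x0] in the closure of [W], a closed cylinder around [x0], slightly
smaller than the open one, lies in [W + Z].  On it [h = g o f^-1] differs from
the identity by less than its half-dimensions, so for [p] close to [x0] the map
[z |-> p + z - h z] sends the cylinder to itself; by Brouwer it has a fixed
point, that is [h z = p].

Continuity of [f^-1] is invariance of domain, proved after Kulpa and Tao: if
[f x0] were not interior to the image of a cube, a Lipschitz approximation of
[f^-1] precomposed with a radial push away from a missed point would give a
perturbation of the identity without zeros.

Brouwer's theorem is used in the form "a map of the cube at distance at most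
[r] from the identity has a zero".  Its combinatorial core is a computation in
the cohomology of the torus modulo 2: if functions [c_j] on the lattice jump by
1 exactly along the [j]-th period, the cup product of the [d c_j] evaluates to 1
on the fundamental cycle, so some simplex is crossed by every [c_j]. *)

(** * Crossing simplices on the torus *)

Section Cochains.
Local Open Scope nat_scope.
Variable V : Type.
Variable v0 : V.
Implicit Types (c psi : V -> bool) (cs : seq (V -> bool)) (xs : seq V).

Definition diff c xs : bool := c (head v0 xs) (+) c (head v0 (behead xs)).

(** The Alexander-Whitney cup product modulo 2 of the coboundaries of the functions in [cs]: each
    factor is read on its own edge, in order. *)
Fixpoint cup cs xs : bool :=
  if cs is c :: cs' then diff c xs && cup cs' (behead xs) else true.

Definition del k xs := take k xs ++ drop k.+1 xs.

(** The coboundary of the cochain [E]; signs disappear modulo 2. *)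
Definition bd (E : seq V -> bool) xs : bool :=
  \big[addb/false]_(k < size xs) E (del k xs).

(* The cup product with the 0-cochain [psi] inserted after [cs1]. *)
Fixpoint mixed cs1 psi cs2 xs : bool :=
  if cs1 is c :: cs1' then diff c xs && mixed cs1' psi cs2 (behead xs)
  else psi (head v0 xs) && cup cs2 xs.

Lemma bd_cons E x xs : bd E (x :: xs) = E xs (+) bd (fun l => E (x :: l)) xs.
Proof. by rewrite /bd big_ord_recl /del /= drop0. Qed.

Lemma bd_andl b E xs : bd (fun l => b && E l) xs = b && bd E xs.
Proof. by rewrite /bd big_distrr. Qed.

(** Leibniz rule with an exact first factor: on the first two faces the edges [[y; z]] and [[x; z]]
    add up to [[x; y]], and every later face keeps the edge [[x; y]]. *)
Lemma bd_diff c (E : seq V -> bool) x y z xs :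
  bd (fun l => diff c l && E (behead l)) [:: x, y, z & xs]
  = diff c [:: x; y] && bd E [:: y, z & xs].
Proof.
rewrite !(bd_cons _ x) !(bd_cons _ y) /= {3}/diff /= bd_andl addbA -andb_addl.
rewrite andb_addr; congr (_ && _ (+) _).
by rewrite /diff /=; case: (c x); case: (c y); case: (c z).
Qed.

Lemma bd_cup cs xs : size xs = (size cs).+2 -> bd (cup cs) xs = false.
Proof.
elim: cs xs => [|c cs IH] [|x [|y xs]] //=.
  by case: xs => // _; rewrite /bd !big_ord_recl big_ord0.
case: xs => // z xs [sz]; rewrite bd_diff IH ?andbF //=.
by rewrite sz.
Qed.

Lemma bd_mixed cs1 psi cs2 xs : size xs = (size cs1 + size cs2).+2 ->
  bd (mixed cs1 psi cs2) xs = cup (cs1 ++ psi :: cs2) xs.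
Proof.
elim: cs1 xs => [|c cs1 IH] [|x [|y xs]] //=; last first.
  case: xs => // z xs [sz]; rewrite bd_diff IH //=.
  by rewrite sz.
(* [cup cs2] is a cocycle, so its values on the faces that keep [x] sum to its value on the face
   without [x]; this brings out the factor [psi x (+) psi y]. *)
move=> sz; have := @bd_cup cs2 [:: x, y & xs] sz.
rewrite !(bd_cons _ x) /= bd_andl /diff /=.
set A := cup cs2 _; set B := bd _ _.
by case: A; case: B; case: (psi x); case: (psi y).
Qed.

Lemma cup_add cs1 c d cs2 xs :
  cup (cs1 ++ (fun v => c v (+) d v) :: cs2) xs =
  cup (cs1 ++ c :: cs2) xs (+) cup (cs1 ++ d :: cs2) xs.
Proof.
elim: cs1 xs => [|b cs1 IH] xs /=; last by rewrite IH andb_addr.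
rewrite -andb_addl; congr (_ && _); rewrite /diff.
by do !case: (_ (head _ _) : bool).
Qed.

Lemma cup_nth cs xs c0 : size cs < size xs ->
  cup cs xs = [forall j : 'I_(size cs),
    nth c0 cs j (nth v0 xs j) != nth c0 cs j (nth v0 xs j.+1)].
Proof.
elim: cs xs => [|c cs IH] [|x xs] //=; first by move=> _; apply/esym/forallP; case.
rewrite ltnS => lt_sz; rewrite IH //.
apply/andP/forallP => [[cxy /forallP H] j|H].
  case: (unliftP ord0 j) => [i ->|->] /=; last by move: cxy; rewrite /diff /= -!nth0;
    do 2!case: (c _).
  by have := H i; rewrite /bump /=.
split; first by have := H ord0; rewrite /diff /=; do 2!case: (c _).
by apply/forallP => i; have := H (lift ord0 i).
Qed.

End Cochains.

(** * The triangulated torus and its fundamental cycle modulo 2 *)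

Section Torus.
Local Open Scope nat_scope.
Variables (m N : nat).
Hypothesis Npos : 0 < N.
Notation n := m.+1.
Notation V := {ffun 'I_n -> nat}.
Notation box := {ffun 'I_n -> 'I_N}.
Notation v0 := ([ffun=> 0] : V).

Definition base (v : box) : V := [ffun i => nat_of_ord (v i)].
Definition shift (a : 'I_n) k (v : V) : V := [ffun i => v i + k * (i == a)].
(* [s i] is the step of the path from [v] to [v + (1, ..., 1)] at which the
   [i]-th coordinate increases. *)
Definition vtx (v : V) (s : 'S_n) k : V := [ffun i => v i + (s i < k)].
Definition simplex v s := [seq vtx v s k | k <- iota 0 n.+1].

(** [h] is the shift modulo [N], a permutation of the box; at the wrap-around the periodicity of [F]
    absorbs the difference [N]. *)
Lemma sum_box_shift (F : V -> bool) a :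
  (forall a' v, F (shift a' N v) = F v) ->
  \big[addb/false]_(v : box) F (shift a 1 (base v)) =
  \big[addb/false]_(v : box) F (base v).
Proof.
move=> perF.
have lt_mod k : k %% N < N by rewrite ltn_mod.
pose h (v : box) : box :=
  [ffun i => if i == a then Ordinal (lt_mod (v i).+1) else v i].
have hinj : injective h.
  move=> u v /ffunP huv; apply/ffunP => i; move: (huv i); rewrite !ffunE.
  case: eqP => // _ [] /eqP;
    rewrite -(addn1 (u i)) -(addn1 (v i)) eqn_modDr !modn_small // => /eqP.
  exact: val_inj.
rewrite [RHS](reindex_inj hinj) /=; apply: eq_bigr => v _.
have [lt|ge] := ltnP (v a).+1 N.
  congr (F _); apply/ffunP => i; rewrite !ffunE; case: eqP => [->|_] /=.
    by rewrite modn_small // muln1 addn1.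
  by rewrite muln0 addn0.
have eqN : (v a).+1 = N by apply/eqP; rewrite eqn_leq ge ltn_ord.
rewrite -[RHS](perF a); congr (F _); apply/ffunP => i; rewrite !ffunE.
case: eqP => [->|_]; last by rewrite /= ?muln0 ?addn0.
by rewrite /= eqN modnn add0n !muln1 addn1.
Qed.

(** Multiplication by [t] pairs even permutations with odd ones of equal value, and the pairs cancel
    modulo 2. *)
Lemma sum_perm_swap (F : 'S_n -> bool) (t : 'S_n) : odd_perm t ->
  (forall s, F (s * t)%g = F s) -> \big[addb/false]_s F s = false.
Proof.
move=> t_odd Ft; rewrite (bigID (@odd_perm _)) /=.
rewrite (reindex_inj (mulIg t)) /=.
rewrite (eq_bigl (fun s : 'S_n => ~~ odd_perm s)); last first.
  by move=> s; rewrite odd_permM t_odd addbT.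
by rewrite (eq_bigr F) ?addbb // => s _; rewrite Ft.
Qed.

Definition periodic (E : seq V -> bool) :=
  forall a xs, size xs = n -> E [seq shift a N x | x <- xs] = E xs.

Lemma shift_vtx v a k s j : vtx (shift a k v) s j = shift a k (vtx v s j).
Proof. by apply/ffunP => i; rewrite !ffunE addnAC. Qed.

Lemma del_simplex v s k : k <= n ->
  del k (simplex v s) = [seq vtx v s j | j <- iota 0 k ++ iota k.+1 (n - k)].
Proof.
move=> le_kn; rewrite /del /simplex -map_take -map_drop map_cat.
rewrite take_iota drop_iota add0n subSS.
by rewrite (minn_idPl _) // ltnW.
Qed.

(* The simplices [(v, s)] triangulate the torus, so their sum is a cycle
   modulo 2: an inner face is shared by [s] and [s * tperm], and the face
   opposite to the first vertex is opposite to the last one in the next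
   simplex. *)
Lemma torus_cycle E : periodic E ->
  \big[addb/false]_(v : box) \big[addb/false]_(s : 'S_n)
     bd E (simplex (base v) s) = false.
Proof.
move=> perE.
pose T k := \big[addb/false]_(v : box) \big[addb/false]_(s : 'S_n)
     E (del k (simplex (base v) s)).
transitivity (\big[addb/false]_(k < n.+1) T k).
  rewrite /T [RHS]exchange_big; apply: eq_bigr => v _; rewrite [RHS]exchange_big.
  by apply: eq_bigr => s _; rewrite /bd size_map size_iota.
rewrite big_ord_recl big_ord_recr /= big1 => [|k _]; last first.
  apply: big1 => v _.
  have ltk1 : k.+1 < n by rewrite ltnS.
  have ltk0 : k < n by apply: ltnW.
  apply: (@sum_perm_swap _ (tperm (Ordinal ltk0) (Ordinal ltk1))).
    by rewrite odd_tperm -val_eqE /= neq_ltn ltnSn.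
  move=> s; congr (E _); rewrite !del_simplex; try by rewrite /bump /= add1n ltnW.
  apply/eq_in_map => j; rewrite mem_cat !mem_iota /bump /= !add1n => jk.
  (* Exchanging the steps [k] and [k.+1] moves only the vertex [k.+1], which this face omits. *)
  have {}jk : j != k.+1.
    by apply: contraL jk => /eqP ->; rewrite add0n !ltnn ?andbF.
  apply/ffunP => i; rewrite !ffunE permM; congr (_ + _).
  have ltkj : (k < j) = (k.+1 < j).
    by rewrite [LHS]leq_eqVlt eq_sym (negbTE jk).
  by case: tpermP => [->|->|//] /=; rewrite ltkj.
rewrite addFb.
(* Adding [m] modulo [n] lowers a step index by one and sends 0 to the last. With [a] the coordinate
   that [s] increases first, the path of [s * r] from [shift a 1 v] follows the path of [s] from its
   second vertex on. *)
have lt_rot (i : 'I_n) : (i + m) %% n < n by rewrite ltn_mod.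
pose rot (i : 'I_n) : 'I_n := Ordinal (lt_rot i).
have rot_inj : injective rot.
  by move=> i j [] /eqP; rewrite eqn_modDr !modn_small // => /eqP/val_inj.
pose r := perm rot_inj.
suff -> : T 0 = T (bump 0 m) by rewrite addbb.
rewrite /T exchange_big [RHS]exchange_big /=.
rewrite [RHS](reindex_inj (mulIg r)) /=; apply: eq_bigr => s _.
pose a := (s^-1)%g ord0.
pose F v := E (del n (simplex v (s * r)%g)).
rewrite -[RHS](@sum_box_shift F a); last first.
  move=> a' v; rewrite /F -[RHS](perE a'); last first.
    by rewrite del_simplex // size_map size_cat !size_iota subnn addn0.
  congr (E _); by rewrite !del_simplex // -map_comp; apply: eq_map => j /=;
    rewrite shift_vtx.
apply: eq_bigr => v _; rewrite /F; congr (E _); rewrite !del_simplex //.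
rewrite subnn cats0 subn0 cat0s (iotaDl 1 0) -map_comp.
apply/eq_in_map => j; rewrite mem_iota add0n => /andP[_ ltj].
apply/ffunP => i; rewrite !ffunE permM permE /rot /= mul1n -addnA add1n.
congr (_ + _).
have -> : (i == a) = (s i == ord0) by rewrite /a (canF_eq (permK s)).
case: (unliftP ord0 (s i)) => [l ->|->].
  by rewrite /= /bump /= add1n addSnnS modnDr modn_small // ltnS ltnW ?(ltn_ord l).
by rewrite /= add0n modn_small // ltnNge -ltnS ltj addn0.
Qed.

(** * Cup products evaluated on the torus *)

Definition total cs : bool :=
  \big[addb/false]_(v : box) \big[addb/false]_(s : 'S_n)
     cup v0 cs (simplex (base v) s).

(** Such a [c] need not descend to the torus, but its coboundary does, as a 1-cocycle with period
    [b a] along the [a]-th loop. *)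
Definition quasiper (b : 'I_n -> bool) (c : V -> bool) :=
  forall a v, c (shift a N v) = c v (+) b a.

Inductive allquasi : seq (V -> bool) -> Prop :=
| allquasi_nil : allquasi [::]
| allquasi_cons c b cs : quasiper b c -> allquasi cs -> allquasi (c :: cs).

Lemma diff_periodic c b xs a : quasiper b c -> 1 < size xs ->
  diff v0 c [seq shift a N x | x <- xs] = diff v0 c xs.
Proof.
move=> qc; case: xs => [|x [|y xs]] //= _; rewrite /diff /= !qc.
by case: (c x); case: (c y); case: (b a).
Qed.

Lemma cup_periodic cs xs a : allquasi cs -> size cs < size xs ->
  cup v0 cs [seq shift a N x | x <- xs] = cup v0 cs xs.
Proof.
move=> q; elim: q xs => [|c b {}cs qc _ IH] [|x xs] //= ltsz.
by rewrite -map_cons (diff_periodic _ qc) ?IH //; apply: leq_trans ltsz.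
Qed.

Lemma mixed_periodic cs1 psi cs2 xs a :
  allquasi cs1 -> allquasi cs2 -> quasiper (fun=> false) psi ->
  size cs1 + size cs2 < size xs ->
  mixed v0 cs1 psi cs2 [seq shift a N x | x <- xs] = mixed v0 cs1 psi cs2 xs.
Proof.
move=> q1 q2 qpsi; elim: q1 xs => [|c b {}cs1 qc _ IH] [|x xs] //= ltsz.
  by rewrite -map_cons cup_periodic // qpsi addbF.
by rewrite -map_cons (diff_periodic _ qc) ?IH //; apply: leq_trans ltsz.
Qed.

(** Equal periods mean cohomologous coboundaries: the sum [psi] is periodic, and the two products
    differ by the coboundary of [mixed cs1 psi cs2], which sums to zero over the cycle. *)
Lemma total_replace cs1 c d cs2 b :
  allquasi cs1 -> allquasi cs2 -> quasiper b c -> quasiper b d ->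
  (size cs1 + size cs2).+1 = n ->
  total (cs1 ++ c :: cs2) = total (cs1 ++ d :: cs2).
Proof.
move=> q1 q2 qc qd sz; apply/eqP; rewrite -negb_add; apply/negbT.
pose psi v := c v (+) d v.
have qpsi : quasiper (fun=> false) psi.
  by move=> a v; rewrite /psi qc qd; case: (c v); case: (d v); case: (b a).
have per : periodic (mixed v0 cs1 psi cs2).
  by move=> a xs szx; apply: mixed_periodic => //; rewrite szx; apply: eq_leq.
rewrite -[RHS](torus_cycle per) /total -big_split; apply: eq_bigr => v _ /=.
rewrite -big_split; apply: eq_bigr => s _ /=.
by rewrite bd_mixed ?cup_add // size_map size_iota (f_equal S (esym sz)).
Qed.

(* The cochain [carry j] is the generator of the cohomology of the torus in
   direction [j]; only the simplex with [s = 1] at the corner has all its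
   steps crossing. *)
Definition carry (j : 'I_n) (v : V) := odd (v j %/ N).

Lemma carry_quasiper j : quasiper (fun a => a == j) (carry j).
Proof.
move=> a v; rewrite /carry ffunE addnC mulnC divnMDl // [j == a]eq_sym.
by case: (a == j); rewrite ?oddD ?addTb ?addbT ?add0n ?addbF.
Qed.

Lemma cup_simplex (c : 'I_n -> V -> bool) u s :
  cup v0 [seq c j | j <- enum 'I_n] (simplex u s) =
  [forall j : 'I_n, c j (vtx u s j) != c j (vtx u s j.+1)].
Proof.
have sz : size [seq c j | j <- enum 'I_n] = n by rewrite size_map size_enum_ord.
rewrite (cup_nth v0 (fun=> false)); last by rewrite sz size_map size_iota.
have nthE (j : 'I_n) : nth (fun=> false) [seq c j | j <- enum 'I_n] j = c j.
  by rewrite (nth_map ord0) ?size_enum_ord // nth_ord_enum.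
have simE k : k <= n -> nth v0 (simplex u s) k = vtx u s k.
  by move=> lek; rewrite (nth_map 0) ?size_iota // nth_iota.
have stepE (j : 'I_n) : (c j (nth v0 (simplex u s) j) !=
    c j (nth v0 (simplex u s) j.+1)) = (c j (vtx u s j) != c j (vtx u s j.+1)).
  by rewrite (simE _ (ltnW (ltn_ord j))) (simE _ (ltn_ord j)).
apply/forallP/forallP => [H j|H j].
  by have := H (cast_ord (esym sz) j); rewrite /= nthE stepE.
have := H (cast_ord sz j); rewrite -stepE -[in X in X -> _](nthE (cast_ord sz j)).
by [].
Qed.

Lemma total_carry : total [seq carry j | j <- enum 'I_n].
Proof.
have lt_m1 : N.-1 < N by rewrite prednK.
pose vm : box := [ffun=> Ordinal lt_m1].
have cupE v s : cup v0 [seq carry j | j <- enum 'I_n] (simplex (base v) s)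
   = (v == vm) && (s == 1%g).
  rewrite cup_simplex /carry.
  apply/forallP/andP => [H|[/eqP -> /eqP ->] i]; last first.
    by rewrite !ffunE /= perm1 ltnn ltnSn addn0 addn1 prednK // divnn Npos divn_small.
  (* Coordinate [j] changes only at step [s j], so a crossing at step [j] forces equality. *)
  have s1 j : s j = j.
    have := H j; rewrite !ffunE; apply: contraNeq => /eqP nsj.
    have /negbTE nsj' : nat_of_ord (s j) != j by apply/eqP => /val_inj.
    by rewrite [s j < j.+1]leq_eqVlt eqSS nsj'.
  split; last by apply/eqP/permP => j; rewrite s1 perm1.
  apply/eqP/ffunP => j; apply/val_inj; rewrite ffunE /=.
  have := H j; rewrite !ffunE s1 ltnn ltnSn addn0 addn1 divn_small //.
  have [lt|ge] := ltnP (v j).+1 N; first by rewrite divn_small.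
  by move=> _; apply/eqP; rewrite eqn_leq -ltnS prednK // ltn_ord -ltnS prednK.
rewrite /total (bigD1 vm) //= [X in _ (+) X]big1 => [|v nv]; last first.
  by apply: big1 => s _; rewrite cupE (negbTE nv).
rewrite (bigD1 1%g) //= big1 => [|s ns]; last first.
  by rewrite cupE (negbTE ns) andbF.
by rewrite cupE !eqxx.
Qed.

Lemma total_quasiper (c : 'I_n -> V -> bool) :
  (forall j, quasiper (fun a => a == j) (c j)) ->
  total [seq c j | j <- enum 'I_n].
Proof.
move=> qc.
have quasi d r : (forall j, quasiper (fun a => a == j) (d j)) ->
    allquasi [seq d j | j <- r].
  by move=> qd; elim: r => [|j r IH] /=; [left | apply: allquasi_cons IH].
(* The factors are replaced one at a time; [r1] lists the indices already switched to [carry]. *)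
have key r2 r1 : size r1 + size r2 = n ->
    total ([seq carry j | j <- r1] ++ [seq c j | j <- r2]) =
    total ([seq carry j | j <- r1] ++ [seq carry j | j <- r2]).
  elim: r2 r1 => [//|j r2 IH] r1 /= sz.
  rewrite (@total_replace _ (c j) (carry j) _ (fun a => a == j)) ?size_map //;
    try exact: quasi carry_quasiper; try exact: quasi.
  - by rewrite -cat_rcons -map_rcons IH ?size_rcons ?addSnnS // map_rcons cat_rcons.
  - exact: carry_quasiper.
  - by rewrite -addnS.
by have /= -> := key (enum 'I_n) [::]; rewrite ?total_carry // size_enum_ord.
Qed.

Lemma crossing_simplex (c : 'I_n -> V -> bool) :
  (forall j, quasiper (fun a => a == j) (c j)) ->
  exists (v : box) (s : 'S_n), forall j,
    c j (vtx (base v) s j) != c j (vtx (base v) s j.+1).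
Proof.
move=> /total_quasiper tot.
case E: [exists v : box, exists s : 'S_n, forall j : 'I_n,
           c j (vtx (base v) s j) != c j (vtx (base v) s j.+1)].
  by case/existsP: E => v /existsP[s /forallP H]; exists v, s.
move: tot; rewrite /total big1 // => v _; apply: big1 => s _.
move/negbT/existsPn/(_ v)/existsPn/(_ s): E => E.
by rewrite cup_simplex; apply/negbTE.
Qed.

End Torus.

(** * From the torus to a box *)

Section Box.
Local Open Scope nat_scope.

(* Fold the torus of period [2 * N] onto the box; the second half of each
   period contributes no crossing. *)
Lemma box_crossing (m N : nat) (b : 'I_m.+1 -> {ffun 'I_m.+1 -> nat} -> bool) :
  0 < N ->
  (forall j (v : {ffun 'I_m.+1 -> nat}), v j = 0 -> b j v = false) ->
  (forall j (v : {ffun 'I_m.+1 -> nat}), v j = N -> b j v) ->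
  exists v : {ffun 'I_m.+1 -> nat}, (forall i, v i < N) /\
    forall j, exists x y : {ffun 'I_m.+1 -> nat},
      (forall i, v i <= x i <= (v i).+1) /\ (forall i, v i <= y i <= (v i).+1) /\
      b j x = false /\ b j y.
Proof.
move=> Npos b0 bN.
pose M := N + N.
have Mpos : 0 < M by rewrite addn_gt0 Npos.
have NM : N < M by rewrite -[X in X < _]addn0 ltn_add2l.
pose fold (v : {ffun 'I_m.+1 -> nat}) : {ffun 'I_m.+1 -> nat} :=
  [ffun i => minn (v i %% M) (M - v i %% M)].
pose c j (v : {ffun 'I_m.+1 -> nat}) := odd (v j %/ M) (+) ((N <=
  v j %% M) || b j (fold v)).
have qc j : quasiper M (fun a => a == j) (c j).
  move=> a v; rewrite /c.
  have -> : fold (shift a M v) = fold v.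
    by apply/ffunP => i; rewrite !ffunE addnC mulnC modnMDl.
  have /= := carry_quasiper Mpos j a v; rewrite /carry => ->.
  rewrite ffunE addnC mulnC modnMDl.
  by rewrite -!addbA; congr (_ (+) _); rewrite addbC.
have [v [s cross]] := crossing_simplex Mpos qc.
pose x k := vtx (base v) s k.
have xb k i : base v i <= x k i <= (base v i).+1.
  by rewrite /x [vtx _ _ _ _]ffunE leq_addr /= -(addn1 (base v i)) leq_add2l leq_b1.
(* On the second half of the period [c j] is constantly true. This includes the endpoint [M], where
   [fold] gives 0 and the parity has flipped; hence a crossing cell lies in the first half. *)
have c1 j (u : {ffun 'I_m.+1 -> nat}) : N <= u j -> u j <= M -> c j u.
  move=> Nu; rewrite leq_eqVlt => /orP[/eqP uM|uM]; rewrite /c.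
    rewrite uM divnn Mpos modnn leqNgt Npos /= b0 //.
    by rewrite ffunE uM modnn min0n.
  by rewrite divn_small // modn_small // Nu.
have vN i : base v i < N.
  rewrite ltnNge; apply/negP => Nv; have := cross i.
  have vM : (base v i).+1 <= M by rewrite ffunE; exact: ltn_ord.
  have xc k : c i (x k).
    have /andP[lo hi] := xb k i.
    by apply: c1; [exact: leq_trans lo | exact: leq_trans vM].
  by rewrite -!/(x _) !xc.
exists (base v); split=> // j.
have foldE k : fold (x k) = x k.
  apply/ffunP => i; rewrite ffunE.
  have xN : x k i <= N by have /andP[_ /leq_trans] := xb k i; apply.
  have xM : x k i < M by apply: leq_ltn_trans xN NM.
  rewrite modn_small //; apply/minn_idPl.
  by rewrite leq_subRL ?(ltnW xM) // leq_add.
have cE k : c j (x k) = b j (x k).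
  have xN : x k j <= N by have /andP[_ /leq_trans] := xb k j; apply.
  have xM : x k j < M by apply: leq_ltn_trans xN NM.
  rewrite /c foldE divn_small // modn_small //=.
  case: ltngtP xN => //= eqN _.
  by rewrite bN.
have := cross j; rewrite -!/(x _) !cE.
case E1: (b j (x j)); case E2: (b j (x j.+1)) => // _.
  by exists (x j.+1), (x j); split; [|split].
by exists (x j), (x j.+1); split; [|split].
Qed.
End Box.

(** * Zeros of perturbations of the identity *)

Lemma epsilon_choice (A B : Type) (P : A -> B -> Prop) :
  (forall x, exists y, P x y) -> exists h, forall x, P x (h x).
Proof.
move=> H; pose h x := constructive_indefinite_description _ (H x).
by exists (fun x => proj1_sig (h x)) => x; exact: (proj2_sig (h x)).
Qed.

Lemma inv_succ_lt e : 0 < e -> exists K, forall k, (K <= k)%N -> / INR k.+1 < e.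
Proof.
move=> e0; have [K [Ke K0]] := archimed_cor1 e e0.
exists K => k /leP Kk; apply: Rle_lt_trans Ke.
apply: Rinv_le_contravar; first by apply: (lt_INR 0).
by apply: le_INR; lia.
Qed.

Lemma inv_succ_gt0 k : 0 < / INR k.+1.
Proof. by apply: Rinv_0_lt_compat; apply: (lt_INR 0); lia. Qed.

(** * Compactness of cubes *)

Definition converges {T : eqType} (s : seq T) (u : nat -> T -> R) (a : T -> R) :=
  forall e, 0 < e -> exists K, forall k, (K <= k)%N ->
    forall i, i \in s -> Rabs (u k i - a i) < e.

Lemma bounded_subseq1 (u : nat -> R) r : (forall k, Rabs (u k) <= r) ->
  exists (phi : nat -> nat) l, (forall k, (k <= phi k)%N) /\
    forall k, Rabs (u (phi k) - l) < / INR k.+1.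
Proof.
move=> ub.
have ub' k : - r <= u k <= r by move: (ub k); split_Rabs; lra.
have [l adh] := Bolzano_Weierstrass u _ (compact_P3 (- r) r) ub'.
have /epsilon_choice[phi Hphi] k : exists p, (k <= p)%N /\ Rabs (u p - l) < / INR k.+1.
  have [|p [/leP kp Hp]] := adh (disc l (mkposreal _ (inv_succ_gt0 k))) k.
    by exists (mkposreal _ (inv_succ_gt0 k)) => x.
  by exists p.
by exists phi, l; split=> k; case: (Hphi k).
Qed.

(** Coordinates are treated one after another. The condition [k <= phi k] is stable under
    composition and is all that passing to a limit requires. *)
Lemma bounded_subseq (T : eqType) (s : seq T) (u : nat -> T -> R) r :
  (forall k i, i \in s -> Rabs (u k i) <= r) ->
  exists (phi : nat -> nat) a, (forall k, (k <= phi k)%N) /\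
    converges s (fun k => u (phi k)) a.
Proof.
elim: s => [|i s IH] ub.
  by exists id, (fun=> 0); split=> // e _; exists 0%N.
have [|phi [a [phile cv]]] := IH; first by move=> k j js; apply: ub; rewrite inE js orbT.
have [|theta [l [thle tcv]]] := @bounded_subseq1 (fun k => u (phi k) i) r.
  by move=> k; apply: ub; rewrite mem_head.
exists (phi \o theta), (fun j => if j == i then l else a j); split.
  by move=> k; apply: leq_trans (thle k) (phile _).
move=> e e0; have [K HK] := cv e e0; have [K' HK'] := inv_succ_lt e0.
exists (maxn K K') => k; rewrite geq_max => /andP[kK kK'] j.
rewrite inE; case: eqP => [-> _|_ /= js].
  exact: Rlt_trans (tcv k) (HK' _ kK').
by apply: HK => //; apply: leq_trans kK (thle k).
Qed.

Lemma converges_subseq (T : eqType) (s : seq T) u a (theta : nat -> nat) :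
  (forall k, (k <= theta k)%N) -> converges s u a ->
  converges s (fun k => u (theta k)) a.
Proof.
move=> thle cv e /cv[K HK]; exists K => k kK.
by apply: HK; apply: leq_trans kK (thle k).
Qed.

Lemma converges_bound (T : eqType) (s : seq T) u a c r : converges s u a ->
  (forall k i, i \in s -> Rabs (u k i - c i) <= r) ->
  forall i, i \in s -> Rabs (a i - c i) <= r.
Proof.
move=> cv ub i ins; apply: le_epsilon => e e0.
have [K HK] := cv e e0; move: (HK K (leqnn _) i ins) (ub K i ins).
by split_Rabs; lra.
Qed.

Definition cube {n} (x0 : vec n) r : vset n := fun x => forall i, Rabs (x i - x0 i) <= r.

Lemma cube_subseq n (u : nat -> vec n) x0 r : (forall k, cube x0 r (u k)) ->
  exists (phi : nat -> nat) a, [/\ forall k, (k <= phi k)%N, cube x0 r a &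
    converges (enum 'I_n) (fun k => u (phi k)) a].
Proof.
move=> uK.
have [|phi [a [phile cv]]] :=
  @bounded_subseq _ (enum 'I_n) (fun k i => u k i - x0 i) r.
  by move=> k i _; apply: uK.
have cv' : converges (enum 'I_n) (fun k => u (phi k)) (fun i => a i + x0 i).
  move=> e /cv[K HK]; exists K => k kK i ii.
  by have := HK k kK i ii; congr (Rabs _ < _); ring.
exists phi, (fun i => a i + x0 i); split=> // i.
by apply: (converges_bound cv'); rewrite ?mem_enum // => k j _; apply: uK.
Qed.

Definition rcont {n} (S : vset n) (h : vec n -> R) := forall x, S x ->
  forall e, 0 < e -> exists d, 0 < d /\ forall y, S y ->
    (forall i, Rabs (y i - x i) < d) -> Rabs (h y - h x) < e.

(** The hypothesis gives [F x i] opposite weak signs on opposite faces, as in the Poincaré-Miranda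
    theorem. Finer and finer grids give cells in which every coordinate of [F] takes both signs; by
    compactness the cells accumulate at a point, which is a zero by continuity. *)
Lemma near_identity_zero m (F : vec m.+1 -> vec m.+1) x0 r : 0 < r ->
  (forall i, rcont (cube x0 r) (fun x => F x i)) ->
  (forall x, cube x0 r x -> forall i, Rabs (F x i - (x i - x0 i)) <= r) ->
  exists x, cube x0 r x /\ forall i, F x i = 0.
Proof.
move=> r0 Fc Fid.
pose pt N (v : {ffun 'I_m.+1 -> nat}) : vec m.+1 :=
  fun i => x0 i - r + 2 * r * INR (v i) * / INR N.+1.
have N0 N : 0 < INR N.+1 by apply: (lt_INR 0); lia.
have ptK N (v : {ffun _}) : (forall i, (v i <= N.+1)%N) -> cube x0 r (pt N v).
  move=> vN i; have /leP/le_INR Hv := vN i; rewrite /pt.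
  have := pos_INR (v i) => v0.
  have : 0 <= INR (v i) * / INR N.+1 <= 1.
    split; first by apply: Rmult_le_pos => //; left; apply: Rinv_0_lt_compat.
    apply: (Rmult_le_reg_r (INR N.+1)) => //.
    by rewrite Rmult_assoc Rinv_l; [lra | apply: Rgt_not_eq].
  by rewrite Rmult_assoc; move: (_ * / _) => t [t0 t1]; split_Rabs; nra.
have /epsilon_choice[z Hz] N : exists z, cube x0 r z /\ forall j,
    (exists x, [/\ cube x0 r x,
       forall i, Rabs (x i - z i) <= 2 * r * / INR N.+1 & F x j <= 0]) /\
    (exists y, [/\ cube x0 r y,
       forall i, Rabs (y i - z i) <= 2 * r * / INR N.+1 & 0 <= F y j]).
  (* The values on opposite faces are forced, as [box_crossing] requires; there the weak sign of [F]
     comes from [Fid]. *)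
  pose b j (v : {ffun 'I_m.+1 -> nat}) := (v j != 0%N) &&
    ((v j == N.+1) || (if Rlt_dec 0 (F (pt N v) j) then true else false)).
  have [] := @box_crossing m N.+1 b isT.
  - by move=> j v v0; rewrite /b v0.
  - by move=> j v vN; rewrite /b vN eqxx.
  move=> v [vN cr]; exists (pt N v); split; first by apply: ptK => i; apply: ltnW.
  have near (x : {ffun 'I_m.+1 -> nat}) : (forall i, (v i <= x i <= (v i).+1)%N) ->
      cube x0 r (pt N x) /\ forall i, Rabs (pt N x i - pt N v i) <= 2 * r * / INR N.+1.
    move=> vx; split; first by apply: ptK => i; case/andP: (vx i) => _ /leq_trans; apply.
    move=> i; case/andP: (vx i) => /leP/le_INR lo /leP/le_INR; rewrite S_INR => hi.
    rewrite /pt; have := Rinv_0_lt_compat _ (N0 N); move: (/ _) => w w0.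
    have : 0 <= 2 * r * w * (INR (x i) - INR (v i)) <= 2 * r * w * 1.
      by split; [apply: Rmult_le_pos | apply: Rmult_le_compat_l]; try lra;
         apply: Rmult_le_pos; lra.
    by split_Rabs; lra.
  move=> j; have [x [y [/near[xK xz] [/near[yK yz] [bx by_]]]]] := cr j; split.
    exists (pt N x); split=> //; move: bx; rewrite /b; case: eqP => [xj0 _|_] /=.
      have := Fid _ xK j; rewrite {2}/pt xj0 /=; split_Rabs; lra.
    by case: eqP => //= _; case: Rlt_dec => // ? _; lra.
  exists (pt N y); split=> //; move: by_; rewrite /b; case/andP=> _ /orP[/eqP yj|].
    have := Fid _ yK j; rewrite {2}/pt yj.
    have -> : x0 j - r + 2 * r * INR N.+1 * / INR N.+1 - x0 j = r.
      by rewrite Rmult_assoc Rinv_r; [ring | apply: Rgt_not_eq].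
    by split_Rabs; lra.
  by case: Rlt_dec => // ? _; lra.
have [phi [a [phile aK cv]]] := cube_subseq (fun k => proj1 (Hz k)).
exists a; split=> // j; apply: cond_eq => e e0; rewrite Rminus_0_r.
have [d [d0 Hd]] := Fc j a aK e e0.
have [K HK] := cv (d / 2) ltac:(lra).
have [K' HK'] := @inv_succ_lt (d / 2 / (2 * r)) ltac:(apply: Rdiv_lt_0_compat; lra).
pose k := maxn K K'.
have zk : forall i, Rabs (z (phi k) i - a i) < d / 2.
  by move=> i; apply: HK; rewrite ?leq_maxl ?mem_enum.
have sm : 2 * r * / INR (phi k).+1 < d / 2.
  have := HK' (phi k) (leq_trans (leq_maxr _ _) (phile k)) => H.
  apply: (Rmult_lt_reg_r (/ (2 * r))); first by apply: Rinv_0_lt_compat; lra.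
  by apply: Rle_lt_trans H; right; field; split; [apply: Rgt_not_eq | lra].
have [_ /(_ j) [[x [xK xz Fx]] [y [yK yz Fy]]]] := Hz (phi k).
have H1 : Rabs (F x j - F a j) < e.
  by apply: Hd => // i; move: (xz i) (zk i); split_Rabs; lra.
have H2 : Rabs (F y j - F a j) < e.
  by apply: Hd => // i; move: (yz i) (zk i); split_Rabs; lra.
by move: H1 H2; split_Rabs; lra.
Qed.

(** Uniform continuity of the inverse on a compact cube: if it failed, pairs at least [s] apart in
    some coordinate, with images ever closer, would have limits [a] and [b] with equal images,
    against injectivity. *)
Lemma injective_modulus m (f : vec m.+1 -> vec m.+1) x0 r :
  (forall i, rcont (cube x0 r) (fun x => f x i)) -> injective_on f (cube x0 r) ->
  forall s, 0 < s -> exists mu, 0 < mu /\ forall x x', cube x0 r x -> cube x0 r x' ->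
    (forall i, Rabs (f x i - f x' i) <= mu) -> forall i, Rabs (x i - x' i) < s.
Proof.
move=> fc finj s s0; apply: NNPP => none.
have /epsilon_choice[u Hu] (k : nat) : exists u : vec m.+1 * vec m.+1,
    [/\ cube x0 r u.1, cube x0 r u.2, forall i, Rabs (f u.1 i - f u.2 i) <= / INR k.+1
      & exists i, s <= Rabs (u.1 i - u.2 i)].
  apply: NNPP => no; apply: none; exists (/ INR k.+1); split; first exact: inv_succ_gt0.
  move=> x x' xK x'K fxx i; apply: Rnot_le_lt => le; apply: no.
  by exists (x, x'); split=> //; exists i.
have [phi [a [phile aK cva]]] := 
  @cube_subseq _ (fun k => (u k).1) x0 r (fun k => let: And4 h _ _ _ := Hu k in h).
have [theta [b [thle bK cvb]]] := 
  @cube_subseq _ (fun k => (u (phi k)).2) x0 r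
    (fun k => let: And4 _ h _ _ := Hu (phi k) in h).
have {}cva := converges_subseq thle cva.
have near e : 0 < e -> exists K, (forall i, Rabs ((u (phi (theta K))).1 i - a i) < e)
   /\ (forall i, Rabs ((u (phi (theta K))).2 i - b i) < e) /\ / INR (phi (theta K)).+1 < e.
  move=> e0; have [K1 H1] := cva e e0; have [K2 H2] := cvb e e0.
  have [K3 H3] := inv_succ_lt e0; exists (maxn K1 (maxn K2 K3)).
  split; [|split].
  - by move=> i; apply: H1; rewrite ?leq_maxl ?mem_enum.
  - by move=> i; apply: H2; rewrite ?mem_enum // leq_max leq_maxl orbT.
  apply: H3; apply: leq_trans (phile _); apply: leq_trans (thle _).
  by rewrite !leq_max leqnn !orbT.
have ab : a = b.
  apply: finj => //; apply: functional_extensionality => i.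
  apply: cond_eq => e e0.
  have [d1 [d10 Hd1]] := fc i a aK (e / 3) ltac:(lra).
  have [d2 [d20 Hd2]] := fc i b bK (e / 3) ltac:(lra).
  have [K [H1 [H2 H3]]] :=
    near (Rmin (e / 3) (Rmin d1 d2)) ltac:(repeat apply Rmin_glb_lt; lra).
  have [uK vK fuv _] := Hu (phi (theta K)).
  have := Rmin_l (e / 3) (Rmin d1 d2); have := Rmin_r (e / 3) (Rmin d1 d2).
  have := Rmin_l d1 d2; have := Rmin_r d1 d2 => m1 m2 m3 m4.
  have A1 := Hd1 _ uK (fun i => ltac:(move: (H1 i); lra)).
  have A2 := Hd2 _ vK (fun i => ltac:(move: (H2 i); lra)).
  by move: A1 A2 (fuv i); split_Rabs; lra.
have [K [H1 [H2 _]]] := near (s / 2) ltac:(lra).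
have [_ _ _ [i si]] := Hu (phi (theta K)).
by move: (H1 i) (H2 i) si; rewrite ab; split_Rabs; lra.
Qed.

(** * Lipschitz images of spheres *)

Lemma nat_floor N s : 0 <= s <= INR N.+1 ->
  exists a : 'I_N.+1, INR a <= s <= INR a + 1.
Proof.
elim: N => [|N IH] [s0 sN].
  by exists ord0; move: sN; rewrite /=; lra.
case: (Rle_lt_dec s (INR N.+1)) => [le|gt].
  have [a Ha] := IH (conj s0 le); exists (widen_ord (leqnSn _) a) => /=.
  exact: Ha.
exists ord_max; rewrite -[nat_of_ord ord_max]/N.+1.
by move: sN; rewrite (S_INR N.+1); lra.
Qed.

Lemma grid_approx N e z : (0 < N)%N -> 0 < e -> Rabs z <= e ->
  exists a : 'I_N, Rabs (z - (- e + 2 * e * INR a * / INR N)) <= 2 * e * / INR N.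
Proof.
case: N => // N _.
move=> e0 ze.
have N0 : 0 < INR N.+1 by apply: (lt_INR 0); lia.
have zb : 0 <= (z + e) * / (2 * e) <= 1.
  have e2 : 0 < / (2 * e) by apply: Rinv_0_lt_compat; lra.
  split; first by apply: Rmult_le_pos; move: ze; split_Rabs; lra.
  apply: (Rmult_le_reg_r (2 * e)); first lra.
  by rewrite Rmult_assoc Rinv_l; move: ze; split_Rabs; lra.
have [|a [lo hi]] := @nat_floor N ((z + e) * / (2 * e) * INR N.+1).
  by split; [apply: Rmult_le_pos; lra | nra].
exists a; set t := (z + e) * _ * _ in lo hi.
have -> : z - (- e + 2 * e * INR a * / INR N.+1) = 2 * e * / INR N.+1 * (t - INR a).
  by rewrite /t; field; lra.
have : 0 < 2 * e * / INR N.+1.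
  by apply: Rmult_lt_0_compat; [lra | apply: Rinv_0_lt_compat].
by move: (2 * e * _) => w w0; rewrite Rabs_pos_eq; nra.
Qed.

(* Counting: a grid of mesh [1 / N] on the sphere has [O(N ^ m)] points, too
   few to reach all the points of a grid of mesh [1 / M] in a cube of
   dimension [m.+1] when [N] is a fixed multiple of a large [M]. *)
Lemma lipschitz_sphere_gap m (P : vec m.+1 -> vec m.+1) k c e tau :
  0 < k -> 0 < e -> 0 < tau ->
  (forall y y' d, (forall j, Rabs (y j - y' j) <= d) ->
     forall i, Rabs (P y i - P y' i) <= k * d) ->
  exists t : vec m.+1, (forall i, Rabs (t i) <= tau) /\
    forall y, cube c e y -> (exists i, Rabs (y i - c i) = e) -> P y <> t.
Proof.
move=> k0 e0 tau0 lip; apply: NNPP => none.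
(* With [N = q * M], this [q] makes [k * (4 * e / N)], the spread of [P] over points sharing a grid
   point, less than the mesh [tau / M] of the targets. *)
have [q0 Hq0] := INR_unbounded (4 * k * e / tau).
pose q := q0.+1.
have Hq : 4 * k * e < tau * INR q.
  have Hq : 4 * k * e / tau < INR q by apply: Rlt_trans Hq0 _; apply: lt_INR;
    rewrite /q; lia.
  apply: (Rmult_lt_reg_r (/ tau)); first exact: Rinv_0_lt_compat.
  apply: Rlt_le_trans Hq _; right; field; lra.
(* The sphere grid has [m.+1 * 2 * N ^ m = D * M ^ m] points, fewer than the [M ^ m.+1] targets
   since [M = D + 1]. *)
pose D := (m.+1 * 2 * q ^ m)%N; pose M := D.+1.
pose N := (q * M)%N.
have Npos : (0 < N)%N by rewrite muln_gt0.
have M0 : 0 < INR M by apply: (lt_INR 0); rewrite /M; lia.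
have q0' : 0 < INR q by apply: (lt_INR 0); rewrite /q; lia.
have NR : INR N = INR q * INR M by rewrite /N -multE mult_INR.
have N0 : 0 < INR N by rewrite NR; apply: Rmult_lt_0_compat.
(* An element of [G] names a face by its fixed coordinate and a sign, and a grid point on that
   face. *)
pose G := ('I_m.+1 * bool * {ffun 'I_m -> 'I_N})%type.
pose close (g : G) (y : vec m.+1) := y g.1.1 = c g.1.1 + (if g.1.2 then e else - e) /\
  forall l, Rabs (y (lift g.1.1 l) - (c (lift g.1.1 l) + (- e + 2 * e * INR (g.2 l) * / INR N)))
     <= 2 * e * / INR N.
have closeP y : cube c e y -> (exists i, Rabs (y i - c i) = e) -> exists g, close g y.
  move=> yc [i yi].
  have /epsilon_choice[w Hw] (l : 'I_m) : exists a : 'I_N,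
      Rabs (y (lift i l) - (c (lift i l) + (- e + 2 * e * INR a * / INR N))) <=
        2 * e * / INR N.
    have [a Ha] := @grid_approx N e (y (lift i l) - c (lift i l)) Npos e0 (yc _).
    exists a.
    by apply: Rle_trans Ha; right; congr Rabs; ring.
  exists (i, if Rle_dec 0 (y i - c i) then true else false, [ffun l => w l]).
  split=> [|l] /=; last by rewrite ffunE.
  by case: Rle_dec => ? /=; move: yi; split_Rabs; lra.
pose t (u : {ffun 'I_m.+1 -> 'I_M}) : vec m.+1 := fun i => tau * INR (u i) * / INR M.
have /epsilon_choice[g Hg] u : exists g : G, exists y, close g y /\ P y = t u.
  apply: NNPP => no; apply: none; exists (t u); split.
    move=> i; rewrite /t; have /ltP/lt_INR := ltn_ord (u i); have := pos_INR (u i).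
    move: (INR (u i)) => s s0 sM.
    have : 0 <= s * / INR M <= 1.
      split; first by apply: Rmult_le_pos => //; left; apply: Rinv_0_lt_compat.
      apply: (Rmult_le_reg_r (INR M)) => //.
      by rewrite Rmult_assoc Rinv_l; lra.
    by rewrite Rmult_assoc; move: (_ * / _) => w w01; rewrite Rabs_pos_eq; nra.
  move=> y yc yi Py; apply: no; have [g gy] := closeP y yc yi.
  by exists g, y.
(* Targets with the same code have preimages within [4 * e / N], so by the choice of [q] they differ
   by less than one mesh in each coordinate. *)
have ginj : injective g.
  move=> u u' guu; have [y [gy Py]] := Hg u; have [y' [gy' Py']] := Hg u'.
  have yy j : Rabs (y j - y' j) <= 4 * e * / INR N.
    rewrite -guu in gy'; case: gy => gi gl; case: gy' => gi' gl'.
    have : 0 < e * / INR N by apply: Rmult_lt_0_compat => //; apply: Rinv_0_lt_compat.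
    case: (unliftP (g u).1.1 j) => [l ->|->].
      by move: (gl l) (gl' l); split_Rabs; lra.
    by rewrite gi gi'; split_Rabs; lra.
  apply/ffunP => i; apply/val_inj; have := lip _ _ _ yy i; rewrite Py Py' /t.
  rewrite !(Rmult_assoc tau) -Rmult_minus_distr_l -Rmult_minus_distr_r Rabs_mult Rabs_mult.
  rewrite (Rabs_pos_eq tau); last lra.
  rewrite (Rabs_pos_eq (/ INR M)); last by left; apply: Rinv_0_lt_compat.
  move=> H.
  have {}H : Rabs (INR (u i) - INR (u' i)) < 1.
    apply: (Rmult_lt_reg_r (tau * / INR M)).
      by apply: Rmult_lt_0_compat => //; apply: Rinv_0_lt_compat.
    apply: Rle_lt_trans (_ : k * (4 * e * / INR N) < _).
      by apply: Rle_trans H; right; ring.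
    rewrite NR; apply: (Rmult_lt_reg_r (INR q * INR M)); first by rewrite -NR.
    have -> : k * (4 * e * / (INR q * INR M)) * (INR q * INR M) = 4 * k * e by field; lra.
    by have -> : 1 * (tau * / INR M) * (INR q * INR M) = tau * INR q by field; lra.
  apply/eqP; rewrite eqn_leq; apply/andP; split; rewrite leqNgt; apply/negP => /ltP.
    by move/(le_INR _.+1); rewrite S_INR /=; move: H; split_Rabs; lra.
  by move/(le_INR _.+1); rewrite S_INR /=; move: H; split_Rabs; lra.
have := leq_card _ ginj.
rewrite !card_prod !card_ffun !card_ord card_bool expnMn mulnA expnS leq_pmul2r.
  by rewrite -/D ltnn.
by rewrite expn_gt0.
Qed.

(** * Continuity in the sup distance *)

Lemma finite_common_pos n (P : 'I_n -> R -> Prop) :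
  (forall i d d', 0 < d' <= d -> P i d -> P i d') ->
  (forall i, exists d, 0 < d /\ P i d) -> exists d, 0 < d /\ forall i, P i d.
Proof.
move=> mono /epsilon_choice[D HD].
suff [d [d0 Hd]] : exists d, 0 < d /\ forall i, i \in enum 'I_n -> d <= D i.
  exists d; split=> // i; case: (HD i) => Di0 PDi.
  by apply: mono PDi; split=> //; apply: Hd; rewrite mem_enum.
elim: (enum _) => [|i s [d [d0 Hd]]]; first by exists 1; split=> //; lra.
exists (Rmin d (D i)); split; first by apply: Rmin_glb_lt => //; case: (HD i).
move=> j; rewrite inE => /orP[/eqP ->|js]; first exact: Rmin_r.
by apply: Rle_trans (Rmin_l _ _) (Hd _ js).
Qed.

Section RCont.
Variables (n : nat) (S : vset n).
Implicit Types h : vec n -> R.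

Lemma rcont_ext h h' : (forall x, S x -> h x = h' x) -> rcont S h -> rcont S h'.
Proof.
move=> E hc x xS e e0; have [d [d0 Hd]] := hc x xS e e0.
by exists d; split=> // y yS yx; rewrite -!E //; apply: Hd.
Qed.

Lemma rcont_const a : rcont S (fun=> a).
Proof.
move=> x xS e e0; exists 1; split; first lra.
by move=> y _ _; rewrite Rminus_diag Rabs_R0.
Qed.

Lemma rcont_coord i : rcont S (fun x => x i).
Proof. by move=> x xS e e0; exists e. Qed.

Lemma rcont_lip2 (op : R -> R -> R) h1 h2 :
  (forall a b a' b' d, Rabs (a - a') < d -> Rabs (b - b') < d ->
     Rabs (op a b - op a' b') <= 2 * d) ->
  rcont S h1 -> rcont S h2 -> rcont S (fun x => op (h1 x) (h2 x)).
Proof.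
move=> lip c1 c2 x xS e e0.
have [d1 [d10 H1]] := c1 x xS (e / 3) ltac:(lra).
have [d2 [d20 H2]] := c2 x xS (e / 3) ltac:(lra).
exists (Rmin d1 d2); split; first exact: Rmin_glb_lt.
move=> y yS yx; apply: Rle_lt_trans (_ : 2 * (e / 3) < _); last lra.
have := Rmin_l d1 d2; have := Rmin_r d1 d2 => m2 m1.
by apply: lip; [apply: H1 | apply: H2] => // i; move: (yx i); lra.
Qed.

Lemma rcont_add h1 h2 : rcont S h1 -> rcont S h2 -> rcont S (fun x => h1 x + h2 x).
Proof. by apply: (rcont_lip2 (op := Rplus)) => a b a' b' d; split_Rabs; lra. Qed.

Lemma rcont_sub h1 h2 : rcont S h1 -> rcont S h2 -> rcont S (fun x => h1 x - h2 x).
Proof. by apply: (rcont_lip2 (op := Rminus)) => a b a' b' d; split_Rabs; lra. Qed.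

Lemma rcont_max h1 h2 : rcont S h1 -> rcont S h2 -> rcont S (fun x => Rmax (h1 x) (h2 x)).
Proof.
apply: (rcont_lip2 (op := Rmax)) => a b a' b' d; rewrite /Rmax.
by do 2!case: Rle_dec => ?; split_Rabs; lra.
Qed.

Lemma rcont_abs h : rcont S h -> rcont S (fun x => Rabs (h x)).
Proof.
move=> hc; apply: (rcont_lip2 (op := fun a _ => Rabs a) _ hc hc) => a b a' b' d.
by split_Rabs; lra.
Qed.

Lemma rcont_mul h1 h2 : rcont S h1 -> rcont S h2 -> rcont S (fun x => h1 x * h2 x).
Proof.
move=> c1 c2 x xS e e0.
pose a := Rabs (h1 x); pose b := Rabs (h2 x); pose k := 1 + a + b.
have a0 : 0 <= a by apply: Rabs_pos.
have b0 : 0 <= b by apply: Rabs_pos.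
have k0 : 0 < k by rewrite /k; lra.
pose e' := Rmin 1 (e / k).
have ek : 0 < e / k by apply: Rdiv_lt_0_compat.
have e'0 : 0 < e' by apply: Rmin_glb_lt; lra.
have [d1 [d10 H1]] := c1 x xS e' e'0.
have [d2 [d20 H2]] := c2 x xS e' e'0.
exists (Rmin d1 d2); split; first exact: Rmin_glb_lt.
move=> y yS yx; have := Rmin_l d1 d2; have := Rmin_r d1 d2 => m2 m1.
have {}H1 : Rabs (h1 y - h1 x) < e' by apply: H1 => // i; move: (yx i); lra.
have {}H2 : Rabs (h2 y - h2 x) < e' by apply: H2 => // i; move: (yx i); lra.
have -> : h1 y * h2 y - h1 x * h2 x = (h1 y - h1 x) * (h2 y - h2 x)
  + (h1 y - h1 x) * h2 x + h1 x * (h2 y - h2 x) by ring.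
have e'1 : e' <= 1 by apply: Rmin_l.
have e'k : e' * k <= e.
  have -> : e = e / k * k by field; lra.
  by apply: Rmult_le_compat_r; [lra | apply: Rmin_r].
apply: Rlt_le_trans e'k; rewrite /k.
apply: Rle_lt_trans (Rabs_triang _ _) _.
apply: Rle_lt_trans (Rplus_le_compat_r _ _ _ (Rabs_triang _ _)) _.
rewrite !Rabs_mult -/a -/b.
have := Rabs_pos (h1 y - h1 x); have := Rabs_pos (h2 y - h2 x).
move: (Rabs (h1 y - _)) (Rabs (h2 y - _)) H1 H2 => u v H1 H2 v0 u0.
have : u * v <= u * 1 by apply: Rmult_le_compat_l; lra.
have : u * b <= e' * b by apply: Rmult_le_compat_r; lra.
have : a * v <= a * e' by apply: Rmult_le_compat_l; lra.
by lra.
Qed.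

Lemma rcont_inv h : (forall x, S x -> 0 < h x) -> rcont S h -> rcont S (fun x => / h x).
Proof.
move=> hpos hc x xS e e0; have hx := hpos x xS.
pose a := h x; pose e' := Rmin (a / 2) (e * (a * a / 2)).
have a0 : 0 < a by [].
have aa : 0 < e * (a * a / 2) by apply: Rmult_lt_0_compat => //; nra.
have [d [d0 Hd]] := hc x xS e' ltac:(apply: Rmin_glb_lt; lra).
exists d; split=> // y yS yx; move: (Hd y yS yx); rewrite -/a => H.
have := Rmin_l (a / 2) (e * (a * a / 2)); have := Rmin_r (a / 2) (e * (a * a / 2)).
rewrite -/e' => m2 m1; have hy := hpos y yS; move: (h y) hy H => b b0 H.
have ba : a / 2 < b by move: H; split_Rabs; lra.
have -> : / b - / a = (a - b) * / (b * a) by field; lra.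
have ab : 0 < b * a by apply: Rmult_lt_0_compat.
rewrite Rabs_mult (Rabs_pos_eq (/ _)); last by left; apply: Rinv_0_lt_compat.
apply: (Rmult_lt_reg_r (b * a)) => //.
rewrite Rmult_assoc Rinv_l ?Rmult_1_r; last lra.
rewrite Rabs_minus_sym; apply: Rlt_le_trans H _; apply: Rle_trans m2 _.
by apply: Rmult_le_compat_l; [lra | nra].
Qed.

End RCont.

Lemma rcont_comp n p (S : vset n) (T : vset p) (f : vec n -> vec p) (h : vec p -> R) :
  (forall x, S x -> T (f x)) -> (forall i, rcont S (fun x => f x i)) -> rcont T h ->
  rcont S (fun x => h (f x)).
Proof.
move=> fST fc hc x xS e e0; have [d [d0 Hd]] := hc _ (fST x xS) e e0.
have [||d' [d'0 Hd']] := @finite_common_pos p (fun i d' => forall y, S y ->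
   (forall j, Rabs (y j - x j) < d') -> Rabs (f y i - f x i) < d).
- by move=> i d1 d2 d12 H y yS yx; apply: H => // j; move: (yx j); lra.
- by move=> i; apply: fc.
exists d'; split=> // y yS yx; apply: Hd; first exact: fST.
by move=> i; apply: Hd'.
Qed.

Lemma rcont_subset n (S T : vset n) h : vsubset S T -> rcont T h -> rcont S h.
Proof.
move=> ST hc x /ST xT e e0; have [d [d0 Hd]] := hc x xT e e0.
by exists d; split=> // y /ST; apply: Hd.
Qed.

Definition supdist {n} (x y : vec n) := \big[Rmax/0]_(i < n) Rabs (x i - y i).

Lemma supdist_ge0 n (x y : vec n) : 0 <= supdist x y.
Proof.
rewrite /supdist; elim/big_rec: _ => [|i a _ a0]; first lra.
exact: Rle_trans a0 (Rmax_r _ _).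
Qed.

Lemma coord_le_supdist n (x y : vec n) i : Rabs (x i - y i) <= supdist x y.
Proof.
rewrite /supdist; have : i \in index_enum 'I_n by apply: mem_index_enum.
elim: (index_enum _) => //= j s IH; rewrite inE big_cons.
case/orP => [/eqP -> |/IH H]; first exact: Rmax_l.
exact: Rle_trans H (Rmax_r _ _).
Qed.

Lemma supdist_le n (x y : vec n) d : 0 <= d ->
  (forall i, Rabs (x i - y i) <= d) -> supdist x y <= d.
Proof.
move=> d0 H; rewrite /supdist; elim/big_rec: _ => // i a _ ad.
exact: Rmax_lub.
Qed.

Lemma supdist_attained n (x y : vec n) : 0 < supdist x y ->
  exists i, Rabs (x i - y i) = supdist x y.
Proof.
move=> d0; apply: NNPP => none.
have : supdist x y < supdist x y; last lra.
rewrite {1}/supdist; elim/big_rec: _ => [//|i a _ ad].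
apply: Rmax_lub_lt => //; case: (Rle_lt_or_eq _ _ (coord_le_supdist x y i)) => // E.
by case: none; exists i.
Qed.

Lemma supdist_triangle n (x y z : vec n) : supdist x z <= supdist x y + supdist y z.
Proof.
apply: supdist_le; first by have := supdist_ge0 x y; have := supdist_ge0 y z; lra.
move=> i; have := coord_le_supdist x y i; have := coord_le_supdist y z i.
by split_Rabs; lra.
Qed.

Lemma supdist_sym n (x y : vec n) : supdist x y = supdist y x.
Proof. by apply: eq_bigr => i _; rewrite Rabs_minus_sym. Qed.

Lemma rcont_supdist n p (S : vset n) (f : vec n -> vec p) c :
  (forall i, rcont S (fun x => f x i)) -> rcont S (fun x => supdist (f x) c).
Proof.
move=> fc; rewrite /supdist; elim: (index_enum _) => [|i s IH].
  apply: (@rcont_ext _ _ (fun=> 0)); last exact: rcont_const.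
  by move=> x _; rewrite big_nil.
apply: (@rcont_ext _ _ (fun x => Rmax (Rabs (f x i - c i))
  (\big[Rmax/0]_(i <- s) Rabs (f x i - c i)))); first by move=> x _; rewrite big_cons.
by apply: rcont_max => //; apply: rcont_abs; apply: rcont_sub => //; apply: rcont_const.
Qed.

(** * Invariance of domain *)

(* McShane-type regularization of the inverse of [f]. *)
Lemma lipschitz_inverse_approx n (f : vec n -> vec n) (K : vset n) x0 r k s :
  K x0 -> 0 <= k -> (forall x, K x -> forall i, Rabs (x i - x0 i) <= r) ->
  (forall x x', K x -> K x' -> forall i, x i - x' i <= k * supdist (f x) (f x') + s) ->
  exists Q : vec n -> vec n,
    [/\ forall y y' i, Q y i - Q y' i <= k * supdist y y',
        forall x, K x -> forall i, x i - x0 i <= Q (f x) i <= x i - x0 i + s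
      & forall y b i, (forall x, K x -> x i - x0 i - k * supdist y (f x) <= b) ->
        Q y i <= b].
Proof.
move=> K0 k0 Kr Hs.
(* [Q y i] will be the supremum of these values, each [k]-Lipschitz in [y]. At [y = f x] the point
   [x] itself gives the lower bound. *)
pose E (p : vec n * 'I_n) (v : R) :=
  exists x, K x /\ v = x p.2 - x0 p.2 - k * supdist p.1 (f x).
have [q Hq] : exists q, forall p, is_lub (E p) (q p).
  apply: (epsilon_choice (P := fun p v => is_lub (E p) v)) => p.
  have [||q Hq] := completeness (E p); last by exists q.
    exists r => v [x [xK ->]]; have := Kr x xK p.2.
    have : 0 <= k * supdist p.1 (f x) by apply: Rmult_le_pos => //; apply: supdist_ge0.
    by split_Rabs; lra.
  by exists (x0 p.2 - x0 p.2 - k * supdist p.1 (f x0)), x0.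
have ub y i x : K x -> x i - x0 i - k * supdist y (f x) <= q (y, i).
  by move=> xK; apply: (proj1 (Hq (y, i))); exists x.
have least y b i : (forall x, K x -> x i - x0 i - k * supdist y (f x) <= b) ->
  q (y, i) <= b.
  by move=> H; apply: (proj2 (Hq (y, i))) => v [x [xK ->]]; apply: H.
exists (fun y i => q (y, i)); split=> //.
  move=> y y' i; suff : q (y, i) <= q (y', i) + k * supdist y y' by lra.
  apply: least => x xK; have := ub y' i x xK.
  have : k * supdist y' (f x) <= k * (supdist y y' + supdist y (f x)).
    by apply: Rmult_le_compat_l => //; rewrite (supdist_sym y y'); apply: supdist_triangle.
  by lra.
move=> x xK i; split; last by apply: least => x' x'K; have := Hs x' x x'K xK i;
  rewrite supdist_sym; lra.
have := ub (f x) i x xK.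
have -> : supdist (f x) (f x) = 0; last by lra.
apply: Rle_antisym; last exact: supdist_ge0.
by apply: supdist_le => [|j]; rewrite ?Rminus_diag ?Rabs_R0; lra.
Qed.

(* At [z = c] the inverse is a junk value; [push] is only used away from [c]. *)
Definition push {n} (c : vec n) e : vec n -> vec n :=
  fun z i => c i + (z i - c i) * (Rmax e (supdist z c) * / supdist z c).

Lemma push_outside n (c z : vec n) e : 0 < e -> e <= supdist z c -> push c e z = z.
Proof.
move=> e0 ez; apply: functional_extensionality => i.
by rewrite /push Rmax_right // Rinv_r; lra.
Qed.

Lemma push_inside n (c z : vec n) e : 0 < supdist z c <= e ->
  cube c e (push c e z) /\ exists i, Rabs (push c e z i - c i) = e.
Proof.
move=> [z0 ze].
have pE i : Rabs (push c e z i - c i) = Rabs (z i - c i) * (e * / supdist z c).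
  have w0 : 0 <= e * / supdist z c.
    by apply: Rmult_le_pos; [lra | left; apply: Rinv_0_lt_compat].
  by rewrite /push Rmax_left // -{2}(Rabs_pos_eq _ w0) -Rabs_mult; congr Rabs; ring.
split=> [i|].
  rewrite pE; apply: Rle_trans (_ : supdist z c * (e * / supdist z c) <= _).
    apply: Rmult_le_compat_r; last exact: coord_le_supdist.
    by apply: Rmult_le_pos; [lra | left; apply: Rinv_0_lt_compat].
  by right; field; lra.
by have [i zi] := supdist_attained z0; exists i; rewrite pE zi; field; lra.
Qed.

(** If [c] near [f x0] were missed, take a Lipschitz [P] with [P (f x)] close to [x - x0], and a
    small value [t] that [P] misses on the sphere of radius [e] around [c]. The map
    [P (push c e (f x)) - t] has a zero. If [f x] is far from [c], pushing does nothing and the zero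
    is so close to [x0] that [f x] is near [c] after all; otherwise the pushed point is on the
    sphere, where [P] misses [t]. *)
Lemma invariance_of_domain m (f : vec m.+1 -> vec m.+1) x0 r : 0 < r ->
  (forall i, rcont (cube x0 r) (fun x => f x i)) -> injective_on f (cube x0 r) ->
  exists rho, 0 < rho /\ forall c, (forall i, Rabs (c i - f x0 i) < rho) ->
    exists x, cube x0 r x /\ f x = c.
Proof.
move=> r0 fc finj.
have K0 : cube x0 r x0 by move=> i; rewrite Rminus_diag Rabs_R0; lra.
have [mu1 [mu10 Hmu1]] := injective_modulus fc finj (s := r / 10) ltac:(lra).
(* Since [4 * e <= mu1], images within [4 * e] of [f x0] come from points within [r / 10] of [x0];
   later case distinctions split at this distance. *)
pose e := mu1 / 8; have e0 : 0 < e by rewrite /e; lra.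
have near_x0 x : cube x0 r x -> supdist (f x) (f x0) <= 4 * e ->
    forall i, Rabs (x i - x0 i) < r / 10.
  move=> xK fx; apply: Hmu1 => // i; apply: Rle_trans (coord_le_supdist _ _ i) _.
  by rewrite /e in fx; lra.
exists (e / 2); split; first lra.
move=> c cx0; apply: NNPP => cnot.
have fxc x : cube x0 r x -> 0 < supdist (f x) c.
  move=> xK; apply: Rnot_le_lt => le; apply: cnot; exists x; split=> //.
  apply: functional_extensionality => i; have := coord_le_supdist (f x) c i.
  by split_Rabs; lra.
(* [s] sets the accuracy asked of [P]: a zero at which nothing is pushed will lie within [s] of
   [x0], so its image is within [e / 2] of [f x0]. *)
have [s [s0 [sr Hs]]] : exists s, 0 < s /\ s <= r / 10 /\ forall x, cube x0 r x ->
    (forall i, Rabs (x i - x0 i) < s) -> forall i, Rabs (f x i - f x0 i) < e / 2.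
  have [||d [d0 Hd]] := @finite_common_pos m.+1 (fun i d => forall x, cube x0 r x ->
    (forall i, Rabs (x i - x0 i) < d) -> Rabs (f x i - f x0 i) < e / 2).
  - by move=> i d d' d'd H x xK xx0; apply: H => // j; move: (xx0 j); lra.
  - by move=> i; apply: (fc i x0 K0); lra.
  have dr := Rmin_r d (r / 10); have dd := Rmin_l d (r / 10).
  exists (Rmin d (r / 10)); split; first by apply: Rmin_glb_lt; lra.
  by split=> // x xK xx0 i; apply: Hd => // j; move: (xx0 j); lra.
have [mu2 [mu20 Hmu2]] := injective_modulus fc finj (s := s / 4) ltac:(lra).
have km : 0 < 2 * r / mu2 by apply: Rdiv_lt_0_compat; lra.
have ke : 0 < r / (2 * e) by apply: Rdiv_lt_0_compat; lra.
(* The first slope times [mu2] is [2 * r], the largest coordinate difference in the cube, so only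
   images within [mu2] leave an error, at most [s / 4]. The second keeps points with images at least
   [2 * e] from [y] from making [Q y] positive. *)
pose k := 2 * r / mu2 + r / (2 * e).
have [|x xK|x x' xK x'K i|Q [Qlip Qf Qmax]] :=
  @lipschitz_inverse_approx _ f (cube x0 r) x0 r k (s / 4) K0.
- by rewrite /k; lra.
- exact: xK.
- have d0 := supdist_ge0 (f x) (f x').
  have kd : 0 <= r / (2 * e) * supdist (f x) (f x') by apply: Rmult_le_pos; lra.
  rewrite /k; case: (Rle_lt_dec (supdist (f x) (f x')) mu2) => [le|gt].
    have := Hmu2 x x' xK x'K (fun j => Rle_trans _ _ _ (coord_le_supdist _ _ j) le) i.
    have : 0 <= 2 * r / mu2 * supdist (f x) (f x') by apply: Rmult_le_pos; lra.
    by split_Rabs; lra.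
  have : 2 * r / mu2 * mu2 <= 2 * r / mu2 * supdist (f x) (f x').
    by apply: Rmult_le_compat_l; lra.
  have -> : 2 * r / mu2 * mu2 = 2 * r by field; lra.
  by have := xK i; have := x'K i; split_Rabs; lra.
(* [Q] may be very negative off the image of [f]; the maximum repairs this
   near [f x0] without changing [Q] on the image. *)
pose k0 := r / (4 * e).
have k00 : 0 < k0 by apply: Rdiv_lt_0_compat; lra.
have k0k : k0 <= k.
  rewrite /k (_ : r / (2 * e) = 2 * k0); last by rewrite /k0; field; lra.
  by lra.
pose P y i := Rmax (Q y i) (- (r / 10) - k0 * supdist y (f x0)).
have Plip y y' d : (forall j, Rabs (y j - y' j) <= d) ->
    forall i, Rabs (P y i - P y' i) <= k * d.
  move=> yd i.
  have d0 : 0 <= d by apply: Rle_trans (yd i); apply: Rabs_pos.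
  have yy : supdist y y' <= d by apply: supdist_le.
  have kd : k * supdist y y' <= k * d by apply: Rmult_le_compat_l; lra.
  have := Qlip y y' i; have := Qlip y' y i; rewrite (supdist_sym y' y) => q1 q2.
  have k0d : k0 * supdist y y' <= k * d.
    by apply: Rmult_le_compat => //; [lra | apply: supdist_ge0].
  have t1 : k0 * supdist y (f x0) <= k0 * (supdist y y' + supdist y' (f x0)).
    by apply: Rmult_le_compat_l; [lra | apply: supdist_triangle].
  have t2 : k0 * supdist y' (f x0) <= k0 * (supdist y y' + supdist y (f x0)).
    by apply: Rmult_le_compat_l; [lra | rewrite (supdist_sym y y'); apply:
      supdist_triangle].
  rewrite /P /Rmax; do 2!case: Rle_dec => ?; split_Rabs; lra.
(* On the image the lower barrier stays below [Q]: within [4 * e] of [f x0] it is at most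
   [- r / 10], and beyond, [k0 * (4 * e) = r] puts it below [- r]. *)
have Pf x : cube x0 r x -> forall i, x i - x0 i <= P (f x) i <= x i - x0 i + s / 4.
  move=> xK i; have [q1 q2] := Qf x xK i; rewrite /P Rmax_left //.
  apply: Rle_trans q1.
  case: (Rle_lt_dec (supdist (f x) (f x0)) (4 * e)) => [le|gt].
    have := near_x0 x xK le i.
    have : 0 <= k0 * supdist (f x) (f x0) by apply: Rmult_le_pos; [lra | apply:
      supdist_ge0].
    by split_Rabs; lra.
  have : k0 * (4 * e) <= k0 * supdist (f x) (f x0) by apply: Rmult_le_compat_l; lra.
  have -> : k0 * (4 * e) = r by rewrite /k0; field; lra.
  by have := xK i; split_Rabs; lra.
(* Within [2 * e] of [f x0] the barrier is at least [- r / 10 - r / 2], whence the constant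
   [6 / 10]. *)
have Psmall y : supdist y (f x0) <= 2 * e -> forall i, Rabs (P y i) <= 6 / 10 * r.
  move=> ye i.
  have lo : k0 * supdist y (f x0) <= k0 * (2 * e) by apply: Rmult_le_compat_l; lra.
  rewrite (_ : k0 * (2 * e) = r / 2) in lo; last by rewrite /k0; field; lra.
  have lo0 : 0 <= k0 * supdist y (f x0) by apply: Rmult_le_pos; [lra | apply: supdist_ge0].
  have hi : Q y i <= r / 10.
    apply: Qmax => x xK.
    have ks : 0 <= k * supdist y (f x) by apply: Rmult_le_pos; [lra | apply: supdist_ge0].
    case: (Rle_lt_dec (supdist (f x) (f x0)) (4 * e)) => [le|gt].
      by have := near_x0 x xK le i; split_Rabs; lra.
    have far : 2 * e <= supdist y (f x).
      by have := supdist_triangle (f x) y (f x0); rewrite (supdist_sym (f x) y); lra.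
    have : k * (2 * e) <= k * supdist y (f x) by apply: Rmult_le_compat_l; lra.
    have : r <= k * (2 * e).
      rewrite /k Rmult_plus_distr_r (_ : r / (2 * e) * (2 * e) = r); last by field; lra.
      by have : 0 <= 2 * r / mu2 * (2 * e); [apply: Rmult_le_pos; lra | lra].
    by have := xK i; split_Rabs; lra.
  by rewrite /P /Rmax; case: Rle_dec => ?; split_Rabs; lra.
have [t [ts tP]] := @lipschitz_sphere_gap m P k c e (s / 4) ltac:(lra) e0 ltac:(lra) Plip.
have inside x : supdist (f x) c <= e -> supdist (f x) (f x0) <= 3 / 2 * e.
  have := supdist_triangle (f x) c (f x0).
  have : supdist c (f x0) <= e / 2.
    by apply: supdist_le => [|i]; [lra | apply: Rlt_le; apply: cx0].
  by lra.
pose F x : vec m.+1 := fun i => P (push c e (f x)) i - t i.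
have [|x xK i|x [xK Fx]] := @near_identity_zero m F x0 r r0.
- move=> i; apply: rcont_sub; last exact: rcont_const.
  apply: (@rcont_comp _ _ (cube x0 r) (fun=> True) (fun x => push c e (f x)) (fun y => P y i)) => //.
    move=> j; apply: rcont_add; first exact: rcont_const.
    apply: rcont_mul; first by apply: rcont_sub => //; apply: rcont_const.
    have dc : rcont (cube x0 r) (fun x => supdist (f x) c) by apply: rcont_supdist.
    apply: rcont_mul; first by apply: rcont_max => //; apply: rcont_const.
    exact: rcont_inv.
  move=> y _ b b0; have k_pos : 0 < k by lra.
  exists (b / k / 2); split; first by apply: Rdiv_lt_0_compat; [apply:
    Rdiv_lt_0_compat | lra].
  move=> y' _ yy; apply:
    Rle_lt_trans (Plip y' y (b / k / 2) (fun j => Rlt_le _ _ (yy j)) i) _.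
  have -> : k * (b / k / 2) = b / 2 by field; lra.
  by lra.
(* Where nothing is pushed, the errors of [P] and [t] are at most [s / 4] each. Elsewhere the bounds
   [6 / 10 * r], [s / 4] and [r / 10] on the three terms already add up to less than [r]. *)
- rewrite /F; case: (Rle_lt_dec e (supdist (f x) c)) => [le|lt].
    rewrite push_outside //; have := Pf x xK i; have := ts i.
    by split_Rabs; lra.
  have fx0 := inside x (Rlt_le _ _ lt).
  have [pc _] := @push_inside _ c (f x) e (conj (fxc x xK) (Rlt_le _ _ lt)).
  have pe : supdist (push c e (f x)) (f x0) <= 2 * e.
    apply: Rle_trans (supdist_triangle _ c _) _.
    have : supdist (push c e (f x)) c <= e by apply: supdist_le => //; lra.
    have : supdist c (f x0) <= e / 2.
      by apply: supdist_le => [|j]; [lra | apply: Rlt_le; apply: cx0].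
    by lra.
  have := Psmall _ pe i; have := ts i; have := near_x0 x xK ltac:(lra) i.
  by split_Rabs; lra.
have Pt : P (push c e (f x)) = t.
  by apply: functional_extensionality => i; have := Fx i; rewrite /F; lra.
case: (Rle_lt_dec e (supdist (f x) c)) => [le|lt].
  rewrite push_outside // in Pt.
  have xx0 i : Rabs (x i - x0 i) < s.
    by have := Pf x xK i; rewrite Pt; have := ts i; split_Rabs; lra.
  have [i fi] := supdist_attained (fxc x xK).
  by have := Hs x xK xx0 i; have := cx0 i; move: le; rewrite -fi; split_Rabs; lra.
have [pc pi] := @push_inside _ c (f x) e (conj (fxc x xK) (Rlt_le _ _ lt)).
exact: tP pc pi Pt.
Qed.

(** * Euclidean distance and cylinders *)

Lemma Rplus_associative : associative Rplus.
Proof. by move=> a b c; rewrite Rplus_assoc. Qed.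
HB.instance Definition _ := Monoid.isComLaw.Build R 0 Rplus
  Rplus_associative Rplus_comm Rplus_0_l.

Lemma sum_ge0 (I : Type) (s : seq I) (a : I -> R) : (forall i, 0 <= a i) ->
  0 <= \big[Rplus/0]_(i <- s) a i.
Proof. by move=> a0; elim/big_rec: _ => [|i b _ b0]; [|have := a0 i]; lra. Qed.

(** Each induction step is the triangle inequality in the plane for the vectors [(sqrt A, a i)] and
    [(sqrt B, b i)]. *)
Lemma minkowski (I : Type) (s : seq I) (a b : I -> R) :
  sqrt (\big[Rplus/0]_(i <- s) Rsqr (a i + b i)) <=
  sqrt (\big[Rplus/0]_(i <- s) Rsqr (a i)) + sqrt (\big[Rplus/0]_(i <- s) Rsqr (b i)).
Proof.
elim: s => [|i s]; first by rewrite !big_nil sqrt_0; lra.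
rewrite !big_cons.
have pos h : 0 <= \big[Rplus/0]_(i <- s) Rsqr (h i) by apply: sum_ge0 => j; apply:
  Rle_0_sqr.
have C0 := pos (fun i => a i + b i); move: (pos a) (pos b) C0 => /= {pos}.
set A := \big[_/_]_(j <- s) Rsqr (a j); set B := \big[_/_]_(j <- s) Rsqr (b j).
set C := \big[_/_]_(j <- s) _ => A0 B0 C0 IH.
have := triangle (sqrt A + sqrt B) (a i + b i) 0 0 (sqrt B) (b i).
rewrite /dist_euc !Rminus_0_r.
rewrite (_ : sqrt A + sqrt B - sqrt B = sqrt A); last ring.
rewrite (_ : a i + b i - b i = a i); last ring.
rewrite (Rsqr_sqrt A) // (Rsqr_sqrt B) //.
rewrite (Rplus_comm A) (Rplus_comm B) => tri; apply: Rle_trans tri; apply: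
  sqrt_le_1_alt; rewrite Rplus_comm.
apply: Rplus_le_compat_r; rewrite -{1}(Rsqr_sqrt C) //.
by apply: Rsqr_incr_1 => //; [apply: sqrt_pos | apply: Rplus_le_le_0_compat; apply:
  sqrt_pos].
Qed.

Section VDist.
Variable n : nat.
Implicit Types x y z a b : vec n.

Lemma vdist_add x y a b a' b' : (forall i, x i - y i = (a i - b i) + (a' i - b' i)) ->
  vdist x y <= vdist a b + vdist a' b'.
Proof.
move=> E; rewrite {1}/vdist (eq_bigr (fun i => Rsqr ((a i - b i) + (a' i - b' i)))).
  exact: minkowski.
by move=> i _; rewrite E.
Qed.

Lemma vdist_triangle x y z : vdist x z <= vdist x y + vdist y z.
Proof. by apply: vdist_add => i; ring. Qed.

Lemma vdist_sym x y : vdist x y = vdist y x.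
Proof. by congr sqrt; apply: eq_bigr => i _; rewrite Rsqr_neg_minus. Qed.

Lemma vdist_refl x : vdist x x = 0.
Proof.
rewrite /vdist big1 ?sqrt_0 // => i _; rewrite Rminus_diag; exact: Rsqr_0.
Qed.

Lemma coord_le_vdist x y i : Rabs (x i - y i) <= vdist x y.
Proof.
rewrite -sqrt_Rsqr_abs; apply: sqrt_le_1_alt; rewrite (bigD1 i) //=.
rewrite -{1}[Rsqr _]Rplus_0_r; apply: Rplus_le_compat_l.
by elim/big_rec: _ => [|j s _ s0]; [|have := Rle_0_sqr (x j - y j)]; lra.
Qed.

Lemma vdist_le_coord x y d : 0 <= d -> (forall i, Rabs (x i - y i) <= d) ->
  vdist x y <= INR n * d.
Proof.
move=> d0 xyd; have n0 := pos_INR n.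
have nd0 : 0 <= INR n * d by apply: Rmult_le_pos.
rewrite -[INR n * d]sqrt_Rsqr //; apply: sqrt_le_1_alt.
suff H k (F : 'I_k -> R) : (forall i, F i <= Rsqr d) -> \big[Rplus/0]_(i < k) F i <=
  INR k * Rsqr d.
  apply: Rle_trans (H _ _ _) _ => [i|].
    by apply: Rsqr_le_abs_1; rewrite (Rabs_pos_eq d).
  rewrite Rsqr_mult; apply: Rmult_le_compat_r; first exact: Rle_0_sqr.
  case: (n) => [|k]; first by rewrite Rsqr_0 /=; lra.
  have : 1 <= INR k.+1 by rewrite S_INR; have := pos_INR k; lra.
  by rewrite /Rsqr; nra.
elim: k F => [|k IH] F HF; first by rewrite big_ord0 /=; lra.
rewrite big_ord_recl S_INR Rmult_plus_distr_r Rmult_1_l Rplus_comm.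
by apply: Rplus_le_compat; [apply: IH => i; apply: HF | apply: HF].
Qed.

Lemma vdist_scale x y c t : 0 <= t -> (forall i, x i - c i = (y i - c i) * t) ->
  vdist x c = vdist y c * t.
Proof.
move=> t0 E; rewrite -(sqrt_Rsqr t) // -sqrt_mult_alt; last first.
  by apply: sum_ge0 => i; apply: Rle_0_sqr.
congr sqrt; rewrite (eq_bigr (fun i => Rsqr (y i - c i) * Rsqr t)); last first.
  by move=> i _; rewrite E Rsqr_mult.
by elim/big_rec2: _ => [|i u v _ ->]; ring.
Qed.

Lemma cube_in_ball e : 0 < e -> exists r, 0 < r /\ forall x y, cube x r y -> vdist y x < e.
Proof.
move=> e0; have n0 := pos_INR n.
exists (e / (INR n + 1)); split; first by apply: Rdiv_lt_0_compat; lra.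
move=> x y xy; have r0 : 0 < e / (INR n + 1) by apply: Rdiv_lt_0_compat; lra.
apply: Rle_lt_trans (vdist_le_coord (Rlt_le _ _ r0) xy) _.
have : e = e / (INR n + 1) * (INR n + 1) by field; lra.
by lra.
Qed.

Lemma rcont_vdist p (S : vset p) (f : vec p -> vec n) c :
  (forall i, rcont S (fun u => f u i)) -> rcont S (fun u => vdist (f u) c).
Proof.
move=> fc; apply: (@rcont_comp _ _ S (fun=> True) f (fun y => vdist y c)) => //.
move=> x _ e e0; have [r [r0 Hr]] := cube_in_ball e0; exists r; split=> // y _ yx.
have := Hr x y (fun i => Rlt_le _ _ (yx i)).
have := vdist_triangle y x c; have := vdist_triangle x y c; rewrite (vdist_sym x y).
by split_Rabs; lra.
Qed.

End VDist.

Lemma continuous_on_rcont n p (f : vec n -> vec p) S :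
  continuous_on f S -> forall i, rcont S (fun x => f x i).
Proof.
move=> fc i x xS e e0; have [d [d0 Hd]] := fc x xS e e0.
have [r [r0 Hr]] := cube_in_ball n d0; exists r; split=> // y yS yx.
apply: Rle_lt_trans (coord_le_vdist _ _ i) (Hd y yS _).
by apply: Hr => j; apply: Rlt_le.
Qed.


Lemma coord_ind m (P : 'I_m.+1 -> Prop) :
  (forall j, P (widen_ord (leqnSn m) j)) -> P ord_max -> forall i, P i.
Proof.
move=> Pw Pm i; case: (unliftP ord_max i) => [j ->|-> //].
by rewrite (_ : lift ord_max j = widen_ord (leqnSn m) j) //; apply: val_inj; apply:
  lift_max.
Qed.

Lemma vdist_hatv m (x y : vec m.+1) : vdist (hatv x) (hatv y) <= vdist x y.
Proof.
apply: sqrt_le_1_alt; rewrite big_ord_recr /=.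
by have := Rle_0_sqr (x ord_max - y ord_max); rewrite /hatv; lra.
Qed.

(** By invariance of domain, each [z'] near [z] is the image of a point in a small cube around
    [h z]; injectivity identifies that point with [h z']. *)
Lemma inverse_continuous m (f : vec m.+1 -> vec m.+1) U : is_open U ->
  continuous_on f U -> injective_on f U ->
  exists h : vec m.+1 -> vec m.+1,
    (forall z, vimage f U z -> U (h z) /\ f (h z) = z) /\
    forall i, rcont (vimage f U) (fun z => h z i).
Proof.
move=> Uo fc finj.
have /epsilon_choice[h Hh] z : exists x, vimage f U z -> U x /\ f x = z.
  by case: (classic (vimage f U z)) => [[x xz]|no]; [exists x | exists z].
exists h; split=> // i z zU e e0; have [hU fh] := Hh z zU.
have [e1 [e10 He1]] := Uo _ hU.
have [r [r0 Hr]] := @cube_in_ball m.+1 (Rmin e1 e) ltac:(apply: Rmin_glb_lt; lra).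
have cubeU : vsubset (cube (h z) r) U.
  by move=> x /Hr xh; apply: He1; apply: Rlt_le_trans xh (Rmin_l _ _).
have [||rho [rho0 Hrho]] := @invariance_of_domain m f (h z) r r0.
- by move=> j; apply: rcont_subset cubeU _; apply: continuous_on_rcont.
- by move=> x y /cubeU xU /cubeU yU; apply: finj.
exists rho; split=> // z' z'U zz'.
have [|x [xK fx]] := Hrho z'; first by move=> j; rewrite fh.
have [hU' fh'] := Hh z' z'U.
have -> : h z' = x by apply: finj => //; [apply: cubeU | rewrite fh'].
apply: Rle_lt_trans (coord_le_vdist _ _ _) _.
exact: Rlt_le_trans (Hr _ _ xK) (Rmin_r _ _).
Qed.

(** * Covering by maps close to the identity on a closed cylinder *)

Definition ccyl {m} (x0 : vec m.+1) d e : vset m.+1 := fun z =>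
  vdist (hatv z) (hatv x0) <= d /\ Rabs (lastc z - lastc x0) <= e.

Lemma ccyl_cube m (x0 : vec m.+1) d e : 0 < d -> 0 < e ->
  vsubset (ccyl x0 d e) (cube x0 (d + e)).
Proof.
move=> d0 e0 z [zh zl]; apply: coord_ind => [j|]; last by rewrite /lastc in zl; lra.
by have := coord_le_vdist (hatv z) (hatv x0) j; rewrite /hatv in zh *; lra.
Qed.

(** The factor [min (1, w / t)], in a form that is continuous at [t = 0]. *)
Definition shrink w t := w * / Rmax w t.

Lemma shrink_bounds w t : 0 < w -> 0 <= t -> 0 < shrink w t /\ t * shrink w t <= w.
Proof.
move=> w0 t0; have mw := Rmax_l w t; have mt := Rmax_r w t; rewrite /shrink.
have m0 : 0 < / Rmax w t by apply: Rinv_0_lt_compat; lra.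
split; first exact: Rmult_lt_0_compat.
have -> : t * (w * / Rmax w t) = w * (t * / Rmax w t) by ring.
rewrite -[X in _ <= X](Rmult_1_r w); apply: Rmult_le_compat_l; first lra.
rewrite -(Rinv_r (Rmax w t)); last lra.
by apply: Rmult_le_compat_r; lra.
Qed.

Lemma shrink_id w t : 0 < w -> t <= w -> shrink w t = 1.
Proof. by move=> w0 tw; rewrite /shrink Rmax_left // Rinv_r; lra. Qed.

(** The ball factor and the last coordinate are scaled separately. This extends maps from the
    cylinder to a surrounding cube, where [near_identity_zero] applies. *)
Definition retract {m} (x0 : vec m.+1) d e (x : vec m.+1) : vec m.+1 := fun i =>
  x0 i + (x i - x0 i) *
    (if i == ord_max then shrink e (Rabs (lastc x - lastc x0))
     else shrink d (vdist (hatv x) (hatv x0))).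

Lemma widen_neq_max m (j : 'I_m) : (widen_ord (leqnSn m) j == ord_max) = false.
Proof. by apply/negbTE; rewrite -val_eqE /= neq_ltn ltn_ord. Qed.

Lemma vdist_ge0 n (x y : vec n) : 0 <= vdist x y.
Proof. exact: sqrt_pos. Qed.

Lemma retract_ccyl m (x0 : vec m.+1) d e x : 0 < d -> 0 < e ->
  ccyl x0 d e (retract x0 d e x).
Proof.
move=> d0 e0; split.
  have [s0 sd] := shrink_bounds d0 (vdist_ge0 (hatv x) (hatv x0)).
  rewrite (@vdist_scale _ _ (hatv x) _ (shrink d (vdist (hatv x) (hatv x0)))) //; first lra.
  by move=> j; rewrite /retract /hatv widen_neq_max; ring.
have [s0 sd] := shrink_bounds e0 (Rabs_pos (lastc x - lastc x0)).
rewrite /lastc /retract eqxx -!/(lastc _).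
have -> : x0 ord_max + (x ord_max - x0 ord_max) * shrink e (Rabs (lastc x - lastc x0)) - lastc x0
  = (lastc x - lastc x0) * shrink e (Rabs (lastc x - lastc x0)) by rewrite /lastc; ring.
by rewrite Rabs_mult (Rabs_pos_eq (shrink _ _)); lra.
Qed.

Lemma retract_id m (x0 : vec m.+1) d e x : 0 < d -> 0 < e ->
  ccyl x0 d e x -> retract x0 d e x = x.
Proof.
move=> d0 e0 [xh xl]; apply: functional_extensionality => i.
by rewrite /retract !shrink_id // if_same; ring.
Qed.

Lemma rcont_retract m (x0 : vec m.+1) d e S i : 0 < d -> 0 < e ->
  rcont S (fun x => retract x0 d e x i).
Proof.
move=> d0 e0; apply: rcont_add; first exact: rcont_const.
apply: rcont_mul; first by apply: rcont_sub; [apply: rcont_coord | apply: rcont_const].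
have shc w h : 0 < w -> rcont S h -> rcont S (fun x => shrink w (h x)).
  move=> w0 hc; apply: rcont_mul; first exact: rcont_const.
  apply: rcont_inv; last by apply: rcont_max => //; apply: rcont_const.
  by move=> x _; have := Rmax_l w (h x); lra.
case: (i == ord_max); apply: shc => //.
  by apply: rcont_abs; apply: rcont_sub; [apply: rcont_coord | apply: rcont_const].
by apply: rcont_vdist => j; apply: rcont_coord.
Qed.

(** The offset of [p] and the displacement of [h] together fit in the cylinder, so [phi] maps it to
    itself. A fixed point of [phi] composed with the retraction is a value of [phi], hence lies in
    the cylinder, where the retraction is the identity. *)
Lemma near_identity_covers m (h : vec m.+1 -> vec m.+1) x0 d e a b p : 0 < d -> 0 < e ->
  (forall i, rcont (ccyl x0 d e) (fun z => h z i)) ->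
  (forall z, ccyl x0 d e z ->
     vdist (hatv (h z)) (hatv z) <= a /\ Rabs (lastc (h z) - lastc z) <= b) ->
  vdist p x0 <= d - a -> vdist p x0 <= e - b -> exists z, ccyl x0 d e z /\ h z = p.
Proof.
move=> d0 e0 hc hid pd pe.
pose phi (z : vec m.+1) : vec m.+1 := fun i => p i + z i - h z i.
have phiC z : ccyl x0 d e z -> ccyl x0 d e (phi z).
  move=> zC; have [hz lz] := hid z zC; split.
    apply: Rle_trans (@vdist_add _ _ _ (hatv p) (hatv x0) (hatv z) (hatv (h z)) _) _.
      by move=> i; rewrite /phi /hatv; ring.
    by rewrite (vdist_sym (hatv z)); have := vdist_hatv p x0; lra.
  have := coord_le_vdist p x0 ord_max; move: lz; rewrite /lastc /phi.
  by split_Rabs; lra.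
pose ret := retract x0 d e.
have retC x : ccyl x0 d e (ret x) by apply: retract_ccyl.
have [|x xK i|x [xK Fx]] :=
  @near_identity_zero m (fun x i => x i - phi (ret x) i) x0 (d + e) ltac:(lra).
- move=> i; apply: rcont_sub; first exact: rcont_coord.
  apply: rcont_sub.
    by apply: rcont_add; [apply: rcont_const | apply: rcont_retract].
  apply: (@rcont_comp _ _ _ (ccyl x0 d e) ret (fun z => h z i)) => // j.
  exact: rcont_retract.
- have := ccyl_cube d0 e0 (phiC _ (retC x)) i.
  by split_Rabs; lra.
have xphi : x = phi (ret x) by apply: functional_extensionality => i; have := Fx i; lra.
have xC : ccyl x0 d e x by rewrite xphi; apply: phiC.
exists x; split=> //; apply: functional_extensionality => i.
by have := Fx i; rewrite /ret retract_id // /phi; lra.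
Qed.

(** A point [w] of [W] closer to [x0] than both margins [delta - d] and [eta - e] leaves [z - w]
    inside the open cylinder. *)
Lemma ccyl_msum m (W : vset m.+1) x0 d e delta eta : vclosure W x0 ->
  d < delta -> e < eta -> vsubset (ccyl x0 d e) (msum W (cyl delta eta vzero)).
Proof.
move=> x0W dd ee z [zh zl].
have [w [wW wx]] := x0W (Rmin (delta - d) (eta - e)) ltac:(apply: Rmin_glb_lt; lra).
have m1 := Rmin_l (delta - d) (eta - e); have m2 := Rmin_r (delta - d) (eta - e).
exists w, (fun i => z i - w i); split=> //; split; last first.
  by apply: functional_extensionality => i; rewrite /vadd; ring.
rewrite vdist_sym in wx; split.
  apply: Rle_lt_trans (@vdist_add _ _ _ (hatv z) (hatv x0) (hatv x0) (hatv w) _) _.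
    by move=> i; rewrite /hatv /vzero; ring.
  by have := vdist_hatv x0 w; lra.
have := coord_le_vdist x0 w ord_max; move: zl; rewrite /lastc /vzero.
by split_Rabs; lra.
Qed.

(* The ambient dimension is n = m.+1, so n >= 2 reads (2 <= m.+1). *)
Theorem theorem8p1 (m : nat) (Hn : (2 <= m.+1)%N)
  (U : vset m.+1) (f g : vec m.+1 -> vec m.+1)
  (HU : is_open U)
  (Hfc : continuous_on f U) (Hgc : continuous_on g U)
  (Hfi : injective_on f U) (Hgi : injective_on g U)
  (W : vset m.+1) (HWo : is_open W) (HWc : vconnected W)
  (HWcomp : vcompact (vclosure W)) (HWsub : vsubset (vclosure W) (vimage f U))
  (y : vec m.+1) (delta eta : R) (Hy : W y) (Hd : 0 < delta) (He : 0 < eta)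
  (HyZ : vsubset (translate y (cyl delta eta vzero)) W)
  (HWde : vsubset (vclosure (msum W (cyl delta eta vzero))) (vimage f U)) :
  let A := preimage_on f U (vclosure (msum W (cyl delta eta vzero))) in
  (exists c, c < delta /\
     forall x, A x -> vdist (hatv (g x)) (hatv (f x)) <= c) ->
  (exists c, c < eta /\
     forall x, A x -> Rabs (lastc (g x) - lastc (f x)) <= c) ->
  vsubset (vclosure W) (vinterior (vimage g A)).
Proof.
move=> A [c1 [c1d Hc1]] [c2 [c2e Hc2]] x0 x0W.
(* The midpoint leaves room on both sides: [d < delta] keeps the closed cylinder inside [W + Z], and
   [d - c1] is the slack for moving the target. The maximum with 0 gives [0 < d] whatever the sign
   of [c1]. *)
have [d [d0 [cd dd]]] : exists d, 0 < d /\ c1 < d /\ d < delta.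
  by exists ((Rmax c1 0 + delta) / 2); have := Rmax_l c1 0; have := Rmax_r c1 0;
     have := Rmax_lub_lt _ _ _ c1d Hd; lra.
have [e [e0 [ce ee]]] : exists e, 0 < e /\ c2 < e /\ e < eta.
  by exists ((Rmax c2 0 + eta) / 2); have := Rmax_l c2 0; have := Rmax_r c2 0;
     have := Rmax_lub_lt _ _ _ c2e He; lra.
have [h [hP hc]] := inverse_continuous HU Hfc Hfi.
have CV z : ccyl x0 d e z -> vclosure (msum W (cyl delta eta vzero)) z.
  move=> zC e1 e10; exists z; rewrite vdist_refl; split=> //.
  exact: ccyl_msum x0W dd ee _ zC.
have CA z : ccyl x0 d e z -> A (h z) /\ f (h z) = z.
  move=> /CV zV; have [hU fh] := hP z (HWde z zV).
  by split=> //; split=> //; rewrite fh.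
(* The smaller of the two slacks is the radius of a ball around [x0] covered by [g]. *)
exists (Rmin (d - c1) (e - c2)); split; first by apply: Rmin_glb_lt; lra.
move=> p px0.
have m1 := Rmin_l (d - c1) (e - c2); have m2 := Rmin_r (d - c1) (e - c2).
have [||||z [zC hz]] := @near_identity_covers m (fun z => g (h z)) x0 d e c1 c2 p d0 e0.
- move=> i; apply: (@rcont_comp _ _ _ U h (fun x => g x i)).
  + by move=> z /CA[[]].
  + by move=> j; apply: rcont_subset (hc j) => z /CV; apply: HWde.
  + exact: continuous_on_rcont.
- by move=> z /CA[hA fh]; have := Hc1 _ hA; have := Hc2 _ hA; rewrite fh.
- lra.
- lra.
by exists (h z); split=> //; case: (CA z zC).
Qed.
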